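(* Let $X$ be a Tychonoff $k^*$-metrizable space. Then the following statements are equivalent: (1) $V(X)$ is a $k$-space; (2) $V(X)$ is a $k_{\omega}$-space; (3) $X$ is a $k_{\omega}$-space.
   Context: All vector spaces are over $\mathbb{R}$. For a Tychonoff space $X$, the free topological vector space $V(X)$ is a topological vector space together with a continuous map $i: X\to V(X)$ such that every continuous map $f$ from $X$ to a topological vector space $E$ gives rise to a unique continuous linear operator $\overline{f}: V(X)\to E$ with $f=\overline{f}\circ i$. A space $Y$ is a $k$-space if a subset $C\subseteq Y$ is closed in $Y$ whenever $C\cap K$ is closed in $K$ for each compact subset $K$ of $Y$. A space $Y$ is a $k_\omega$-space if there is a countable family $\{K_n: n\in\mathbb{N}\}$ of compact subsets of $Y$ such that each $F\subseteq Y$ is closed in $Y$ provided that $F\cap K_n$ is closed in $K_n$ for each $n$. A Hausdorff space $X$ is $k^*$-metrizable if there are a metrizable space $M$, a continuous surjection $f: M\to X$ and a (not necessarily continuous) section $s: X\to M$ of $f$ (i.e. $f\circ s=\mathrm{id}_X$) such that for every compact $K\subseteq X$ the set $s(K)$ has compact closure in $M$.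
   Formalization: In the definition of k_ω-space the compact sets K_n are also required to cover Y; without this an uncountable discrete X would satisfy (3) (all K_n empty) while V(X) is not a k-space. *)

(* Defs.v *)
From mathcomp Require Import all_boot all_order all_algebra.
From mathcomp Require Import all_classical all_reals all_analysis.

Set Implicit Arguments.
Unset Strict Implicit.
Unset Printing Implicit Defensive.

Local Open Scope classical_set_scope.
Local Open Scope ring_scope.

(* [completely_regular_space] separates points from closed sets by a coarser
   uniformity; [uniform_separatorP] turns this into real-valued functions. *)
Definition tychonoff_space (X : topologicalType) : Prop :=
  hausdorff_space X /\ completely_regular_space X.

(* The set [C `&` K] is typed in [subspace K], so that [closed] refers to the
   topology induced on [K]. *)
Definition closed_in (Y : topologicalType) (K C : set Y) : Prop :=
  closed (C `&` K : set (subspace K)).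

Definition k_space (Y : topologicalType) : Prop :=
  forall C : set Y, (forall K : set Y, compact K -> closed_in K C) -> closed C.

(* The family is required to cover [Y], as is standard for k_omega-spaces.
   Without this, every discrete space would qualify (take each [K n] empty). *)
Definition k_omega_space (Y : topologicalType) : Prop :=
  exists K : nat -> set Y,
    [/\ forall n, compact (K n),
        \bigcup_n K n = [set: Y]
      & forall F : set Y, (forall n, closed_in (K n) F) -> closed F].

Definition kstar_metrizable (R : realType) (X : topologicalType) : Prop :=
  hausdorff_space X /\
  exists (M : metricType R) (f : M -> X) (s : X -> M),
    [/\ continuous f,
        range f = [set: X],
        (forall x, f (s x) = x)
      & forall K : set X, compact K -> compact (closure (s @` K))].

(* Topological vector spaces are [topologicalLmodType R], which, unlike
   [tvsType R], does not impose local convexity. *)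
Definition is_free_tvs (R : realType) (X : topologicalType)
    (V : topologicalLmodType R) (i : X -> V) : Prop :=
  continuous i /\
  forall (E : topologicalLmodType R) (f : X -> E), continuous f ->
    exists! g : V -> E, [/\ linear g, continuous g & f = g \o i].

(* Main.v *)
Require Import Defs.
From HB Require Import structures.
From mathcomp Require Import all_boot all_order all_algebra.
From mathcomp Require Import all_classical all_reals all_analysis.
From mathcomp Require Import lra.

(* (3) => (2): if [X] is a k_omega-space with compacts [K n], then [V] is
   exhausted by the compact sets [P n] of combinations of at most [n] points of
   the first compacts, with bounded coefficients.  The sets that are open on
   every [P n] form a vector topology making [i] continuous, so by the universal
   property they are open in [V].

   (1) => (3): [X] is a closed subspace of [V], hence a k-space.  Unless [X] is
   hemicompact, the metric space [M] yields either a metric fan in [X] (rows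
   leaving every compact set and converging to a point), or an uncountable
   [E] in [X] meeting every compact set in a finite set.  In both cases one adds
   to small vectors [w t], spanned by at most three points, multiples of the fan
   vectors [z n = i xi_0 + ... + i xi_n].  Since [V] carries continuous gauges
   for which all [a *: i x] have size at most [1 / (n + 1)] while a prescribed
   multiple of [z n] has size [1], the resulting set meets every compact set in
   a finite set, so it is closed; but it accumulates at [0] without containing
   it, a contradiction. *)

Set Implicit Arguments.
Unset Strict Implicit.
Unset Printing Implicit Defensive.

Import Order.TTheory GRing.Theory Num.Theory.
Import numFieldNormedType.Exports.

Local Open Scope classical_set_scope.
Local Open Scope ring_scope.

(** * Vector topologies from a base at the origin *)

(** Axioms for a neighbourhood base at the origin of a vector topology; [zb_comb] packs halving and
    balancedness into one clause. No convexity is demanded, so gauges of L^0 type give such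
    bases. *)
Record zero_base (R : realType) (L : lmodType R) (B : set (set L)) : Prop :=
  ZeroBase {
  zb_nonempty : B !=set0;
  zb_cap : forall U W, B U -> B W -> exists2 Z, B Z & Z `<=` U `&` W;
  zb_comb : forall U, B U -> exists2 W, B W & forall a b u v,
    `|a| <= 1 -> `|b| <= 1 -> W u -> W v -> U (a *: u + b *: v);
  zb_absorb : forall U v, B U -> exists2 d : R, 0 < d &
    forall a, `|a| <= d -> U (a *: v) }.

Section zero_base_theory.
Context {R : realType} {L : lmodType R} {B : set (set L)}.
Hypothesis BP : zero_base B.

Lemma zb0 U : B U -> U 0.
Proof.
by move=> /(zb_absorb BP 0)[d d0 /(_ 0)]; rewrite normr0 scale0r =>
    /(_ (ltW d0)).
Qed.

Lemma zb_add U : B U -> exists2 W, B W & forall u v, W u -> W v -> U (u + v).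
Proof.
move=> /(zb_comb BP)[W BW WU]; exists W => // u v Wu Wv.
by rewrite -[u]scale1r -[v]scale1r; apply: WU; rewrite ?normr1.
Qed.

(** Writing [a *: u] as twice [(a / 2) *: u] turns one application of [zb_add] into a doubling of
    the admissible scalars; iterate until [2 ^+ n] exceeds [c]. *)
Lemma zb_scale (c : R) U : B U ->
  exists2 W, B W & forall a u, `|a| <= c -> W u -> U (a *: u).
Proof.
have H n : forall U, B U ->
    exists2 W, B W & forall a u, `|a| <= 2 ^+ n -> W u -> U (a *: u).
  elim: n => [|n IH] {}U BU.
    have [W BW WU] := zb_comb BP BU; exists W => // a u a1 Wu.
    by rewrite -[_ *: _]addr0 -(scale0r u); apply: WU; rewrite ?normr0.
  have [W BW WU] := zb_add BU; have [Z BZ ZW] := IH _ BW.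
  exists Z => // a u an Zu.
  have -> : a *: u = (a / 2) *: u + (a / 2) *: u by rewrite -scalerDl -splitr.
  have /ZW aW : `|a / 2| <= 2 ^+ n.
    by rewrite normrM normfV (@ger0_norm _ 2)// ler_pdivrMr// -exprSr.
  by apply: WU; exact: aW.
move=> BU.
pose n := Num.truncn c.
have [W BW WU] := H n.+1 _ BU; exists W => // a u ac; apply: WU.
apply: (le_trans ac); apply/ltW/(lt_trans (truncnS_gt c)).
by rewrite -natrX ltr_nat ltn_expl.
Qed.

(** An alias of [L] indexed by the proof of [zero_base B], so that the topology generated by [B] can
    be attached without clashing with one already on [L]. *)
Definition tvs_of (_ : zero_base B) : Type := L.

End zero_base_theory.

Section tvs_of_zero_base.
Context {R : realType} {L : lmodType R} {B : set (set L)} (BP : zero_base B).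
Local Notation T := (tvs_of BP).

HB.instance Definition _ := GRing.Lmodule.copy T L.

Definition zb_nbhs (x : T) : set_system T :=
  [set A | exists2 U, B U & forall u, U u -> A (x + u)].

HB.instance Definition _ := hasNbhs.Build T zb_nbhs.

Let zb_nbhs_filter (x : T) : ProperFilter (nbhs x).
Proof.
split; last split.
- by move=> [U BU /(_ 0 (zb0 BP BU))].
- by have [U BU] := zb_nonempty BP; exists U.
- move=> P Q [U BU UP] [W BW WQ]; have [Z BZ ZUW] := zb_cap BP BU BW.
  by exists Z => // u /ZUW[/UP ? /WQ ?].
- by move=> P Q PQ [U BU UP]; exists U => // u /UP /PQ.
Qed.

Let zb_nbhs_singleton (x : T) (A : set T) : nbhs x A -> A x.
Proof. by move=> [U BU /(_ 0 (zb0 BP BU))]; rewrite addr0. Qed.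

Let zb_nbhs_nbhs (x : T) (A : set T) : nbhs x A -> nbhs x (nbhs^~ A).
Proof.
move=> [U BU UA]; have [W BW WU] := zb_add BP BU.
by exists W => // u Wu; exists W => // w Ww; rewrite -addrA; exact/UA/WU.
Qed.

HB.instance Definition _ := Nbhs_isNbhsTopological.Build T
  zb_nbhs_filter zb_nbhs_singleton zb_nbhs_nbhs.

Let zb_add_continuous : continuous (fun x : T * T => x.1 + x.2).
Proof.
move=> [x y] A [U BU UA] /=; rewrite /= in UA; have [W BW WU] := zb_add BP BU.
exists ([set x + u | u in W], [set y + u | u in W]); first by split;
    exists W => // u Wu; exists u.
move=> [x1 y1] [/= [u Wu <-] [v Wv <-]]; rewrite addrACA.
by apply: UA; exact: WU.
Qed.

HB.instance Definition _ :=
  PreTopologicalNmodule_isTopologicalNmodule.Build T zb_add_continuous.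

Let zb_scale_continuous : continuous (fun z : R^o * T => z.1 *: z.2).
Proof.
move=> [a x] A [U BU UA] /=; have [W BW WU] := zb_add BP BU.
have [Z BZ ZW] := zb_scale BP (`|a| + 1) BW.
have [d d0 dW] := zb_absorb BP x BW.
exists ([set b : R^o | `|b - a| < Num.min 1 d], [set x + u | u in Z]).
  split; last by exists Z => // u Zu; exists u.
  apply/nbhs_ballP; exists (Num.min 1 d) => /=; first by rewrite lt_min ltr01.
  by move=> b; rewrite /ball/= distrC.
move=> [b _] [/=] ba [u Zu <-].
move: ba; rewrite lt_min => /andP[b1 bd].
(* The error splits into [b *: u], small because [b] stays bounded by [|a| + 1], and [(b - a) *: x],
   small by absorption of the fixed vector [x]. *)
have -> : b *: (x + u) = a *: x + (b *: u + (b - a) *: x).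
  by rewrite scalerDr scalerBl addrCA [a *: x + _]addrC subrK addrC.
apply/UA/WU; last by apply: dW; exact: ltW.
apply: ZW => //; rewrite -[b](subrK a) addrC (le_trans (ler_normD _ _))//.
by rewrite lerD2l ltW.
Qed.

HB.instance Definition _ :=
  TopologicalNmodule_isTopologicalLmodule.Build R T zb_scale_continuous.

Lemma zb_nbhs0 U : B U -> nbhs (0 : T) U.
Proof. by move=> BU; exists U => // u; rewrite add0r. Qed.

End tvs_of_zero_base.

Section subspace_lmod.
Context {R : realType} {L : lmodType R} {P : set L}.
Hypotheses (P0 : P 0) (PD : forall a u v, P u -> P v -> P (a *: u + v)).

Definition sub_lmod (_ : P 0) (_ : forall a u v, P u -> P v -> P (a *: u + v))
  : Type := {v : L | v \in P}.
Local Notation T := (sub_lmod P0 PD).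

Let P_closed : submod_closed (mem P).
Proof. by split=> [|a u v]; rewrite !inE; [exact: P0|exact: PD]. Qed.

HB.instance Definition _ := Choice.on T.
HB.instance Definition _ := SubChoice.on T.
HB.instance Definition _ :=
  GRing.SubChoice_isSubLmodule.Build R L (mem P) T P_closed.

End subspace_lmod.

(** * Limits and neighbourhoods of the origin in a topological vector space *)

Section tvs_theory.
Context {R : realType} {V : topologicalLmodType R}.
Implicit Types (U : set V) (K L : set V) (u v : V) (a b : R).

Lemma tvs_cvgD T (F : set_system T) (f g : T -> V) u v {FF : Filter F} :
  f @ F --> u -> g @ F --> v -> f x + g x @[x --> F] --> u + v.
Proof.
by move=> fu gv; apply: continuous2_cvg => //;
    exact: (@tvs.add_continuous _ (u, v)).
Qed.

Lemma tvs_cvgZ T (F : set_system T) (f : T -> R^o) (g : T -> V) a u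
    {FF : Filter F} :
  f @ F --> a -> g @ F --> u -> f x *: g x @[x --> F] --> a *: u.
Proof.
move=> fu gv; apply: (@continuous2_cvg T R^o V V F FF f g _ a u) => //.
exact: (@tvs.scale_continuous _ _ (a, u)).
Qed.

Lemma tvs_cvgN T (F : set_system T) (f : T -> V) u {FF : Filter F} :
  f @ F --> u -> - f x @[x --> F] --> - u.
Proof.
move=> fu; rewrite -scaleN1r; under eq_fun do rewrite -scaleN1r.
exact: (tvs_cvgZ (cvg_cst _) fu).
Qed.

Lemma tvs_cvgB T (F : set_system T) (f g : T -> V) u v {FF : Filter F} :
  f @ F --> u -> g @ F --> v -> f x - g x @[x --> F] --> u - v.
Proof. by move=> fu gv; apply: tvs_cvgD => //; exact: tvs_cvgN. Qed.

Lemma nbhs_addl v U : nbhs v U <-> nbhs 0 [set u | U (v + u)].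
Proof.
split=> H.
  have : v + u @[u --> 0] --> v + (0 : V).
    exact: (tvs_cvgD (cvg_cst v) cvg_id).
  by rewrite addr0; apply.
have : u - v @[u --> v] --> v - v.
  exact: (tvs_cvgB cvg_id (cvg_cst v)).
rewrite subrr => /(_ _ H) vU.
have {}vU : nbhs v [set u | U (v + (u - v))] := vU.
by apply: filterS vU => u /=; rewrite addrCA subrr addr0.
Qed.

Lemma nbhs0_balanced U : nbhs 0 U ->
  exists2 W, nbhs 0 W & forall a u, `|a| <= 1 -> W u -> U (a *: u).
Proof.
move=> U0; have : nbhs ((0 : R^o), (0 : V)) [set z | U (z.1 *: z.2)].
  by apply: (@tvs.scale_continuous _ V (0, 0)); rewrite /= scale0r.
move=> [[A W] /= [/nbhs_ballP[d /= d0 dA] W0] AWU].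
have d20 : 0 < d / 2 by rewrite divr_gt0.
exists [set u | W ((d / 2)^-1 *: u)].
  have : (d / 2)^-1 *: u @[u --> 0] --> (d / 2)^-1 *: (0 : V).
    exact: (tvs_cvgZ (cvg_cst _) cvg_id).
  by rewrite scaler0; apply.
move=> a u a1 /= Wu; have := AWU (a * (d / 2), (d / 2)^-1 *: u).
rewrite /= scalerA mulfK ?gt_eqF//; apply; split => //=; apply: dA.
rewrite /ball/= sub0r normrN normrM (gtr0_norm d20).
by rewrite (le_lt_trans (ler_piMl _ a1)) ?ltW// ltr_pdivrMr// ltr_pMr// ltr1n.
Qed.

Lemma nbhs0_comb U : nbhs 0 U ->
  exists2 W, nbhs 0 W & forall a b u v,
    `|a| <= 1 -> `|b| <= 1 -> W u -> W v -> U (a *: u + b *: v).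
Proof.
move=> U0; have : nbhs ((0 : V), (0 : V)) [set z | U (z.1 + z.2)].
  by apply: (@tvs.add_continuous V (0, 0)); rewrite /= addr0.
move=> [[A B] /= [A0 B0] ABU].
have [W W0 WAB] := nbhs0_balanced (filterI A0 B0).
exists W => // a b u v a1 b1 Wu Wv; apply: (ABU (_, _)); split => /=.
  by have [] := WAB a u a1 Wu.
by have [] := WAB b v b1 Wv.
Qed.

Lemma nbhs0_absorb U v : nbhs 0 U ->
  exists2 d : R, 0 < d & forall a, `|a| <= d -> U (a *: v).
Proof.
move=> U0; have : a *: v @[a --> (0 : R^o)] --> 0 *: v.
  exact: (tvs_cvgZ cvg_id (cvg_cst v)).
rewrite scale0r => /(_ _ U0) /nbhs_ballP[d /= d0 dU].
exists (d / 2); first by rewrite divr_gt0.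
move=> a ad; apply: dU; rewrite /ball/= sub0r normrN (le_lt_trans ad)//.
by rewrite ltr_pdivrMr// ltr_pMr// ltr1n.
Qed.

End tvs_theory.

(** * Free topological vector spaces *)

Section free_tvs.
Context {R : realType} {X : topologicalType} {V : topologicalLmodType R}.
Context {i : X -> V}.
Hypothesis Vfree : is_free_tvs i.

Lemma free_continuous : continuous i. Proof. by case: Vfree. Qed.

(* Corestricting [i] to the subspace spanned by its image, the extension
   followed by the inclusion is the identity, by uniqueness. *)
Lemma free_ind (P : set V) : P 0 ->
  (forall a u v, P u -> P v -> P (a *: u + v)) -> (forall x, P (i x)) ->
  forall v, P v.
Proof.
move=> P0 PD Pi v.
pose T : lmodType R := sub_lmod P0 PD.
pose j : T -> V := \val.
have jD a (s t : T) : j (a *: s + t) = a *: j s + j t by [].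
pose B := [set j @^-1` U | U in nbhs (0 : V)].
have BP : zero_base B.
  split.
  - by exists (j @^-1` setT); exists setT => //; exact: filterT.
  - move=> _ _ [U U0 <-] [W W0 <-]; exists (j @^-1` (U `&` W)) => //.
    by exists (U `&` W) => //; exact: filterI.
  - move=> _ [U U0 <-]; have [W W0 WU] := nbhs0_comb U0.
    exists (j @^-1` W); first by exists W.
    move=> a b s t a1 b1 Ws Wt; rewrite /= jD.
    by rewrite -[b *: t]addr0 jD addr0; exact: WU.
  - move=> _ t [U U0 <-]; have [d d0 dU] := nbhs0_absorb (j t) U0.
    by exists d => // a /dU; rewrite /= -[a *: t]addr0 jD addr0.
pose h : X -> tvs_of BP := fun x => exist _ (i x) (mem_set (Pi x)).
have ch : continuous h.
  move=> x A [_ [U U0 <-] UA].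
  have : nbhs (i x) [set y | U (y - i x)].
    by apply/nbhs_addl; apply: filterS U0 => u /=; rewrite addrAC subrr add0r.
  move=> /free_continuous xU; have {}xU : nbhs x [set y | U (i y - i x)] := xU.
  apply: filterS xU => y Uy.
  have := UA (h y - h x : T); rewrite /= addrCA subrr addr0; exact.
have cj : continuous (j : tvs_of BP -> V).
  move=> t A /nbhs_addl jA; exists (j @^-1` [set u | A (j t + u)]).
    by eexists; first exact: jA.
  by move=> u /=; rewrite -[in X in _ -> X](scale1r t) jD scale1r.
have [g [[lg cg hg] _]] := Vfree.2 (tvs_of BP) h ch.
have [k [_ kU]] := Vfree.2 V i free_continuous.
have idk : k = id.
  by apply: kU; split => // x; exact: cvg_id.
have jgk : k = j \o g.
  apply: kU; split.
  - by move=> a u w /=; rewrite lg.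
  - by move=> w; apply: continuous_comp; [exact: cg|exact: cj].
  - by apply/funext => x /=; rewrite -[g (i x)]/((g \o i) x) -hg.
have -> : v = j (g v) by rewrite -[RHS]/((j \o g) v) -jgk idk.
by apply: set_mem; exact: valP.
Qed.

Lemma free_linear_ext (g h : V -> V) : linear g -> linear h ->
  g \o i = h \o i -> g = h.
Proof.
move=> lg lh gh; apply/funext; apply: free_ind.
- have g0 : forall g : V -> V, linear g -> g 0 = 0.
    by move=> k lk; have := lk (-1) 0 0; rewrite scaler0 addr0 scaleN1r addNr.
  by rewrite !g0.
- by move=> a u v gu gv; rewrite lg lh gu gv.
- by move=> x; rewrite -[LHS]/((g \o i) x) gh.
Qed.

(** The free topology is the finest vector topology making [i] continuous: extending [i], viewed as
    a map into [V] with the topology of [B], gives a continuous linear map that agrees with the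
    identity on [i], hence everywhere. *)
Lemma free_nbhs0 (B : set (set V)) : zero_base B ->
  (forall U, B U -> forall x, nbhs x [set y | U (i y - i x)]) ->
  forall U, B U -> nbhs 0 U.
Proof.
move=> BP BX U BU; pose h : X -> tvs_of BP := i.
have ch : continuous h.
  move=> x A [W BW WA]; apply: filterS (BX _ BW x) => y /WA.
  by rewrite addrCA subrr addr0.
have [g [[lg cg hg] _]] := Vfree.2 (tvs_of BP) h ch.
have gid : (g : V -> V) = id by apply: free_linear_ext => //; rewrite -hg.
have := cg 0 U; rewrite [g 0](_ : _ = 0); last by rewrite (congr1 (@^~ 0) gid).
move=> /(_ (zb_nbhs0 BP BU)); rewrite /nbhs/=.
by rewrite -[X in _ X]/((g : V -> V) @^-1` U) gid.
Qed.

End free_tvs.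

(** * Functionals extending real functions, and separation in Tychonoff spaces *)

Section extension.
Context {R : realType} {X : topologicalType} {V : topologicalLmodType R}.
Context {i : X -> V}.
Hypothesis Vfree : is_free_tvs i.
Implicit Types (phi : X -> R) (v : V).

Lemma free_functional phi : continuous phi ->
  exists g : V -> R^o, [/\ linear g, continuous g & forall x, g (i x) = phi x].
Proof.
move=> cphi; have [g [[lg cg phig] _]] := Vfree.2 R^o phi cphi.
by exists g; split => // x; rewrite phig.
Qed.

(** Made total by the value zero at discontinuous [phi]; every later use supplies continuity. *)
Definition ext phi : V -> R :=
  if pselect (continuous phi) is left cphi
  then projT1 (cid (free_functional cphi)) else cst 0.

Section continuous_phi.
Variables (phi : X -> R) (cphi : continuous phi).

Lemma extP : [/\ linear (ext phi : V -> R^o), continuous (ext phi) &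
  forall x, ext phi (i x) = phi x].
Proof. by rewrite /ext; case: pselect => // c; case: cid. Qed.

Lemma extE x : ext phi (i x) = phi x. Proof. by case: extP. Qed.

Lemma ext_continuous : continuous (ext phi). Proof. by case: extP. Qed.

Lemma ext_linear a u v : ext phi (a *: u + v) = a * ext phi u + ext phi v.
Proof. by case: extP => + _ _; exact. Qed.

Lemma ext0 : ext phi 0 = 0.
Proof. by have := ext_linear (-1) 0 0; rewrite scaler0 addr0 mulN1r addNr. Qed.

Lemma extD u v : ext phi (u + v) = ext phi u + ext phi v.
Proof. by have := ext_linear 1 u v; rewrite scale1r mul1r. Qed.

Lemma extZ a u : ext phi (a *: u) = a * ext phi u.
Proof. by have := ext_linear a u 0; rewrite ext0 !addr0. Qed.

Lemma extN u : ext phi (- u) = - ext phi u.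
Proof. by rewrite -scaleN1r extZ mulN1r. Qed.

Lemma extB u v : ext phi (u - v) = ext phi u - ext phi v.
Proof. by rewrite extD extN. Qed.

Lemma ext_sum (I : Type) (s : seq I) (F : I -> V) :
  ext phi (\sum_(j <- s) F j) = \sum_(j <- s) ext phi (F j).
Proof.
elim: s => [|j s IH]; first by rewrite !big_nil ext0.
by rewrite !big_cons extD IH.
Qed.

End continuous_phi.

Lemma free_span v : exists s : seq (R * X), v = \sum_(p <- s) p.1 *: i p.2.
Proof.
move: v; apply: (free_ind Vfree).
- by exists [::]; rewrite big_nil.
- move=> a u v [s ->] [t ->]; exists ([seq (a * p.1, p.2) | p <- s] ++ t).
  rewrite big_cat big_map; congr +%R; rewrite scaler_sumr.
  by apply: eq_bigr => p _; rewrite scalerA.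
- by move=> x; exists [:: (1, x)]; rewrite big_seq1 scale1r.
Qed.

(** The points of any representation of [v] serve as a finite support. It is the means of building
    functionals that vanish at [v] but not on a given closed set. *)
Lemma ext_support v : exists ys : seq X, forall phi, continuous phi ->
  (forall y, y \in ys -> phi y = 0) -> ext phi v = 0.
Proof.
have [s ->] := free_span v; exists (map snd s) => phi cphi phi0.
rewrite ext_sum// big_seq big1// => p ps; rewrite extZ// extE// phi0 ?mulr0//.
exact: map_f.
Qed.

End extension.

(** Take the product of one separating function per point of [ys]: it vanishes as soon as one factor
    does, and is 1 where all are. *)
Lemma tychonoff_sep (R : realType) (X : topologicalType) (C : set X)
    (ys : seq X) : tychonoff_space X -> closed C ->
  (forall y, y \in ys -> ~ C y) ->
  exists phi : X -> R, [/\ continuous phi, forall x, 0 <= phi x <= 1,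
    forall y, y \in ys -> phi y = 0 & forall x, C x -> phi x = 1].
Proof.
move=> [_ Xcr] Ccl; elim: ys => [|y ys IH] ysC.
  exists (cst 1); split => //; first by move=> x; exact: cvg_cst.
  by move=> x; rewrite ler01 lexx.
have [|f [cf f01 fy fC]] := IH; first by move=> z zys; apply: ysC;
    rewrite inE zys orbT.
have := Xcr y C Ccl (ysC y (mem_head _ _)).
move=> /(@uniform_separatorP _ R)[g [cg g01 gy gC]].
have {}g01 x : 0 <= g x <= 1 by have := g01 (g x); rewrite /= in_itv/=; apply;
    exists x.
exists (fun x => f x * g x); split.
- by move=> x; apply: cvgM; [exact: cf|exact: cg].
- move=> x; have /andP[f0 f1] := f01 x; have /andP[g0 g1] := g01 x.
  by rewrite mulr_ge0// mulr_ile1.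
- move=> z; rewrite inE => /orP[/eqP ->|/fy ->]; last by rewrite mul0r.
  by rewrite (_ : g y = 0) ?mulr0//; apply: gy; exists y.
- by move=> x Cx; rewrite fC// mul1r; apply: gC; exists x.
Qed.

Lemma closed_seq (X : topologicalType) (s : seq X) : hausdorff_space X ->
  closed [set` s].
Proof.
by move=> /hausdorff_accessible/accessible_finite_set_closed; apply;
    exact: finite_seq.
Qed.

Lemma tychonoff_sep1 (R : realType) (X : topologicalType) (x : X)
    (ys : seq X) : tychonoff_space X -> x \notin ys ->
  exists phi : X -> R, [/\ continuous phi, forall x, 0 <= phi x <= 1,
    forall y, y \in ys -> phi y = 0 & phi x = 1].
Proof.
move=> Xt xys; have [||phi [cphi phi01 phi0 phi1]] :=
    @tychonoff_sep R X [set` [:: x]] ys Xt.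
- by apply: closed_seq; case: Xt.
- by move=> y yys /=; rewrite inE => /eqP yx; rewrite -yx yys in xys.
- by exists phi; split => //; apply: phi1; rewrite /= mem_head.
Qed.

Section free_tychonoff.
Context {R : realType} {X : topologicalType} {V : topologicalLmodType R}.
Context {i : X -> V}.
Hypotheses (Vfree : is_free_tvs i) (Xt : tychonoff_space X).
Local Notation ext := (ext Vfree).

(** Induction on the length of a representation. All terms at the first point [y] are merged into
    one coefficient [d]; a function equal to 1 at [y] and 0 at the other points reads off [d = 0],
    and a shorter representation remains. *)
Lemma ext_eq0 (v : V) : (forall phi : X -> R, continuous phi ->
  (forall x, 0 <= phi x <= 1) -> ext phi v = 0) -> v = 0.
Proof.
have [s ->] := free_span Vfree v.
have [n] := ubnP (size s); elim: n s => // n IH [|[c y] s] /=.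
  by rewrite big_nil.
rewrite ltnS => sn H.
pose t := [seq p <- s | p.2 != y].
have tn : (size t < n)%N by rewrite (leq_ltn_trans _ sn)//
    size_filter count_size.
have [|phi [cphi phi01 phi0 phi1]] := @tychonoff_sep1 R X y (map snd t) Xt.
  by apply/mapP => -[p]; rewrite mem_filter => /andP[/eqP py _] yp; exact: py.
pose d := c + \sum_(p <- s | p.2 == y) p.1.
have E : \sum_(p <- (c, y) :: s) p.1 *: i p.2 =
    d *: i y + \sum_(p <- t) p.1 *: i p.2.
  rewrite big_cons/= (bigID (fun p => p.2 == y))/= addrA big_filter; congr +%R.
  rewrite /d scalerDl scaler_suml; congr +%R.
  by apply: eq_bigr => p /eqP ->.
have d0 : d = 0.
  have := H _ cphi phi01; rewrite E extD// extZ// extE// phi1 mulr1.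
  rewrite ext_sum// big_seq big1 ?addr0// => p pt.
  by rewrite extZ// extE// phi0 ?mulr0//; exact: map_f.
rewrite E d0 scale0r add0r; apply: IH => // psi cpsi psi01.
by have := H _ cpsi psi01; rewrite E d0 scale0r add0r.
Qed.

Lemma free_hausdorff : hausdorff_space V.
Proof.
move=> u v uv; apply/eqP; rewrite -subr_eq0; apply/eqP/ext_eq0 => phi cphi _.
rewrite extB//; apply/eqP; rewrite subr_eq0; apply/eqP.
apply: (@Rhausdorff R) => A B Au Bv.
have ce := @ext_continuous _ _ _ _ Vfree _ cphi.
have [w [Aw Bw]] := uv _ _ (ce _ _ Au) (ce _ _ Bv).
by exists (ext phi w).
Qed.

Lemma free_inj : injective i.
Proof.
move=> x y ixy; apply: contrapT => /eqP xy.
have [|phi [cphi _ phi0 phi1]] := @tychonoff_sep1 R X x [:: y] Xt.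
  by rewrite inE.
have := @extE _ _ _ _ Vfree _ cphi x; rewrite ixy extE// phi1 phi0 ?mem_head//
    => /eqP.
by rewrite eq_sym oner_eq0.
Qed.

Lemma nbhs_ext_lt (phi : X -> R) (v : V) (e : R) : continuous phi ->
  ext phi v < e -> nbhs v [set w | ext phi w < e].
Proof.
move=> cphi ve.
have ne : nbhs (ext phi v) [set r : R^o | r < e].
  by apply: (@open_nbhs_nbhs R^o); split => //; exact: open_lt.
exact: (@ext_continuous _ _ _ _ Vfree _ cphi v _ ne).
Qed.

(** The image of an ultrafilter [F] converges to some [v] in [K]. If [F] converged to no point of
    the support of [v], it would contain a closed set [C] missing that support; a function vanishing
    on the support and equal to 1 on [C] contradicts the convergence. So [F] converges to some [y],
    and [i y = v] by Hausdorffness. *)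
Lemma compact_preimage_free (K : set V) : compact K -> compact (i @^-1` K).
Proof.
move=> Kc; rewrite compact_ultra => F FU FK.
have [v [Kv vF]] := Kc (i @ F) _ FK.
have Fv N : nbhs v N -> F (i @^-1` N).
  move=> vN; have [//|Fn] := in_ultra_setVsetC (i @^-1` N) FU.
  by have [w []] := vF (~` N) N Fn vN.
have [ys ysP] := ext_support Vfree v.
have [y [yys Fy]] : exists y, y \in ys /\ F --> y.
  apply: contrapT => nF.
  have H y : exists G : set X, open G /\ (y \in ys -> G y /\ F (~` G)).
    have [yys|yys] := boolP (y \in ys); last by exists setT; split => //;
        exact: openT.
    have /existsNP[N /not_implyP[yN FN]] : ~ F --> y by move=> Fy; apply: nF;
        exists y.
    move: yN; rewrite nbhsE => -[G [Oo Oy] ON]; exists G; split => // _;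
        split => //.
    by have [/(filterS ON)|] := in_ultra_setVsetC G FU.
  have [G OP] := choice H.
  have cC : closed (~` (\bigcup_(y in [set` ys]) G y)).
    by apply: open_closedC; apply: bigcup_open => y _; have [] := OP y.
  have [|phi [cphi phi01 phi0 phi1]] := @tychonoff_sep R X _ ys Xt cC.
    by move=> y yys; apply; exists y => //; have [_ /(_ yys)[]] := OP y.
  have FC : F (~` (\bigcup_(y in [set` ys]) G y)).
    rewrite setC_bigcup -bigsetI_fset_set; last exact: finite_seq.
    rewrite big_seq; apply: (big_ind F); [exact: filterT|by move=> *;
        exact: filterI|].
    move=> y; rewrite in_fset_set ?inE; last exact: finite_seq.
    by move=> yys; have [_ /(_ yys)[]] := OP y.
  have := Fv _ (@nbhs_ext_lt phi v 1 cphi (_ : _ < _)).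
  rewrite ysP// => /(_ ltr01) F1.
  have [x [/= + /phi1]] := filter_ex (filterI F1 FC).
  by rewrite extE// => /[swap] ->; rewrite ltxx.
exists y; split => //=; suff -> : i y = v by [].
apply: free_hausdorff => A B Ay Bv.
have FA := Fy _ (free_continuous Vfree Ay).
have [x [Ax Bx]] := filter_ex (filterI FA (Fv _ Bv)).
by exists (i x).
Qed.

Lemma free_k_space : k_space V -> k_space X.
Proof.
move=> Vk C CK.
suff iC : closed (i @` C).
  have -> : C = i @^-1` (i @` C).
    by apply/seteqP; split=> [x Cx|x [y Cy /free_inj <-]] //; exists x.
  by apply: closed_comp => // x _; exact: free_continuous.
apply: Vk => K Kc; apply: closed_subspaceW; apply: compact_closed;
    first exact: free_hausdorff.
have -> : i @` C `&` K = i @` (C `&` i @^-1` K).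
  apply/seteqP; split=> [_ [[x Cx <-] Kx]|_ [x [Cx Kx] <-]]; first by exists x.
  by split => //; exists x.
apply: continuous_compact; first by apply: continuous_subspaceT;
    exact: free_continuous.
have Kx := compact_preimage_free Kc.
have := CK _ Kx; rewrite /closed_in => /closed_subspaceP[D Dcl].
rewrite -setIA setIid => <-; rewrite setIC.
exact: compact_closedI.
Qed.

End free_tychonoff.

(** * The k_omega property passes from X to V *)

(** If [Q K] failed, the sets whose complement in [K] satisfies [Q] would form a proper filter on
    [K] without cluster point. *)
Lemma compact_local_ind (T : topologicalType) (Q : set T -> Prop) (K : set T) :
  compact K -> Q set0 -> (forall A B, A `<=` B -> Q B -> Q A) ->
  (forall A B, Q A -> Q B -> Q (A `|` B)) ->
  (forall x, K x -> exists2 N, nbhs x N & Q (K `&` N)) -> Q K.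
Proof.
move=> Kc Q0 QS QU Kl; apply: contrapT => nQ.
pose F : set_system T := [set A | Q (K `\` A)].
have FP : ProperFilter F.
  split; first by rewrite /F/= setD0.
  split.
  - by rewrite /F/= setDT.
  - by move=> A B FA FB; rewrite /F/= setDIr; exact: QU.
  - by move=> A B AB; apply: QS => x [Kx Bx]; split => // /AB.
have [x [Kx xF]] : K `&` cluster F !=set0 by apply: Kc; rewrite /F/= setDv.
have [N xN QN] := Kl x Kx.
have FN : F (~` N) by rewrite /F/= setDE setCK.
by have [y []] := xF _ _ FN xN.
Qed.

Lemma tvs_compact_sep (R : realType) (V : topologicalLmodType R)
    (T D : set V) : compact T -> closed D -> T `&` D = set0 ->
  exists2 U, nbhs 0 U & forall t u, T t -> U u -> ~ D (t + u).
Proof.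
move=> Tc Dcl TD.
apply: (@compact_local_ind _ (fun A => exists2 U, nbhs 0 U &
  forall t u, A t -> U u -> ~ D (t + u)) T Tc).
- by exists setT => //; exact: filterT.
- by move=> A B AB [U U0 BU]; exists U => // t u /AB; exact: BU.
- move=> A B [U U0 AU] [W W0 BW]; exists (U `&` W); first exact: filterI.
  by move=> t u [At|Bt] [Uu Wu]; [exact: AU|exact: BW].
- move=> t Tt; have tD : nbhs t (~` D).
    apply: open_nbhs_nbhs; split; first exact: closed_openC.
    by move=> Dt; have : (T `&` D) t by []; rewrite TD.
  have [W W0 WD] := nbhs0_comb ((nbhs_addl _ _).1 tD).
  exists [set s | W (s - t)].
    apply/nbhs_addl; apply: filterS W0 => u /=.
    by rewrite addrAC subrr add0r.
  exists W => // s u [_ /= Ws] Wu.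
  have := WD 1 1 _ _ _ _ Ws Wu; rewrite normr1 !scale1r /=.
  by rewrite addrA [t + _]addrC subrK; apply.
Qed.

Lemma closure_addl (R : realType) (V : topologicalLmodType R) (A W : set V) :
  nbhs 0 W -> closure A `<=` [set a + w | a in A & w in W].
Proof.
move=> W0 x Ax; have : nbhs x [set y | W (x - y)].
  apply/nbhs_addl; have [Z Z0 ZW] := nbhs0_balanced W0.
  apply: filterS Z0 => u Zu /=; rewrite opprD addrA subrr add0r -scaleN1r.
  by apply: ZW; rewrite ?normrN ?normr1.
by move=> /Ax[y [Ay Wy]]; exists y => //; exists (x - y) => //;
    rewrite addrC subrK.
Qed.

Lemma itv_compact (R : realType) (c : R) : compact [set a : R^o | `|a| <= c].
Proof.
have := @segment_compact R (- c) c; congr (compact _).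
by apply/seteqP; split => a /=; rewrite in_itv/= ler_norml.
Qed.

(** * The direct limit topology of a compact exhaustion *)

Section exhaustion.
Context {R : realType} {V : topologicalLmodType R}.
Variable P : nat -> set V.
Hypotheses (Vh : hausdorff_space V) (Pc : forall n, compact (P n)).
Hypotheses (P0 : P 0%N 0) (Pmono : forall n m, (n <= m)%N -> P n `<=` P m).
Hypothesis Padd : forall n m u v, P n u -> P m v -> P (n + m)%N (u + v).
Hypothesis Pbal : forall n (a : R) u, `|a| <= 1 -> P n u -> P n (a *: u).
Hypothesis Pcover : forall v, exists n, P n v.

(** The closed sets of the direct limit topology of the compact sets [P n]. *)
Definition exh_closed (F : set V) := forall n, closed (F `&` P n).

Let Pcl n : closed (P n). Proof. exact: compact_closed. Qed.

Let comb_avoid (F C : set V) := forall (a b : R) u v,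
  `|a| <= 1 -> `|b| <= 1 -> C u -> C v -> ~ F (a *: u + b *: v).

(** One step of thickening: the compact set [T] of balanced combinations of [C] keeps a uniform
    distance from [F], so [C] can grow by a neighbourhood [Z] of 0 inside [P n.+1]. Taking the
    closure keeps compactness and costs one more copy of [Z]. *)
Let exh_step (F : set V) n (C : set V) : exh_closed F ->
  compact C -> C `<=` P n -> comb_avoid F C ->
  exists C' : set V, [/\ compact C', C' `<=` P n.+1, comb_avoid F C' &
    exists2 U, nbhs 0 U & forall c u, C c -> U u -> P n.+1 (c + u) -> C' (c + u)].
Proof.
move=> Fcl Cc CP CF.
(* Combinations of two elements of [P n.+1] lie in [P N], so only the closed part [F] within [P N]
   has to be avoided. *)
pose N := (n.+1 + n.+1)%N.
pose I := [set a : R^o | `|a| <= 1].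
pose T := (fun z : (R^o * V) * (R^o * V) => z.1.1 *: z.1.2 + z.2.1 *: z.2.2) @`
  ((I `*` C) `*` (I `*` C)).
have Tc : compact T.
  apply: continuous_compact; last first.
    by apply: compact_setX; apply: compact_setX => //; exact: itv_compact.
  apply: continuous_subspaceT => -[[a u] [b v]] /=.
  apply: tvs_cvgD; apply: tvs_cvgZ.
  - exact: (cvg_comp _ _ cvg_fst cvg_fst).
  - exact: (cvg_comp _ _ cvg_fst cvg_snd).
  - exact: (cvg_comp _ _ cvg_snd cvg_fst).
  - exact: (cvg_comp _ _ cvg_snd cvg_snd).
have TF : T `&` (F `&` P N) = set0.
  rewrite -subset0 => _ [[[[a u] [b v]] /= [[/= a1 Cu] [/= b1 Cv]] <-] [Fx _]].
  exact: (CF a b u v).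
have [U U0 UF] := tvs_compact_sep Tc (Fcl N) TF.
have [W W0 WU] := nbhs0_comb U0.
have [Z Z0 ZW] := nbhs0_comb W0.
pose A := [set c + z | c in C & z in Z].
exists (P n.+1 `&` closure A); split.
- by apply: compact_closedI => //; exact: closed_closure.
- by move=> x [].
- move=> a b u v a1 b1 [Pu /(closure_addl Z0)[_ [c Cc' [z Zz <-]] [w Zw uE]]].
  move=> [Pv /(closure_addl Z0)[_ [d Cd [y Zy <-]] [x Zx vE]]] Fuv.
  have PN : P N (a *: u + b *: v) by apply: Padd; exact: Pbal.
  have Wu : W (z + w) by rewrite -[z]scale1r -[w]scale1r; apply: ZW;
      rewrite ?normr1.
  have Wv : W (y + x) by rewrite -[y]scale1r -[x]scale1r; apply: ZW;
      rewrite ?normr1.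
  apply: (UF (a *: c + b *: d) (a *: (z + w) + b *: (y + x))).
  + by exists ((a, c), (b, d)).
  + exact: WU.
  + by rewrite addrACA -!scalerDr !addrA uE vE.
- exists Z => // c u Cc' Zu Pcu; split => //; apply: subset_closure.
  by exists c => //; exists u.
Qed.

(** This is the continuity of addition and scaling at 0 for the limit topology. Start from the
    origin alone and thicken once at each level; [G] is the union of the chain. *)
Let exh_open_comb (F : set V) : exh_closed F -> ~ F 0 ->
  exists G : set V, [/\ exh_closed (~` G), G 0 & comb_avoid F G].
Proof.
move=> Fcl F0.
pose good n (C : set V) := [/\ compact C, C `<=` P n & comb_avoid F C].
have H (p : nat * set V) : exists C' : set V, good p.1 p.2 ->
    good p.1.+1 C' /\ exists2 U, nbhs 0 U & forall c u,
      p.2 c -> U u -> P p.1.+1 (c + u) -> C' (c + u).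
  have [[Cc CP CF]|ng] := pselect (good p.1 p.2); last by exists set0.
  by have [C' [? ? ? ?]] := exh_step Fcl Cc CP CF; exists C'.
have [f fP] := choice H.
pose C := fix C n := if n is m.+1 then f (m, C m) else [set 0].
have Cg n : good n (C n).
  elim: n => [|n /(fP (n, C n))[]//]; split => //.
  - exact: compact_set1.
  - by move=> _ ->.
  - by move=> a b _ _ _ _ -> ->; rewrite !scaler0 addr0.
have CU n : exists2 U, nbhs 0 U & forall c u,
    C n c -> U u -> P n.+1 (c + u) -> C n.+1 (c + u).
  by have [] := fP (n, C n) (Cg n).
have CS n : C n `<=` C n.+1.
  move=> c Cc; have [U U0 /(_ c 0 Cc (nbhs_singleton U0))] := CU n.
  by rewrite addr0; apply; have [_ CP _] := Cg n; exact/(Pmono (leqnSn n))/CP.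
have Cm n m : (n <= m)%N -> C n `<=` C m.
  elim: m => [|m IH]; first by rewrite leqn0 => /eqP ->.
  by rewrite leq_eqVlt => /orP[/eqP -> //|/IH nm]; apply: (subset_trans nm).
exists (\bigcup_n C n); split; last 2 first.
- by exists 0%N.
- move=> a b u v a1 b1 [n _ Cu] [m _ Cv].
  have [_ _] := Cg (maxn n m); apply => //.
    exact: (Cm n _ (leq_maxl _ _)).
  exact: (Cm m _ (leq_maxr _ _)).
(* A point of [C n] lies in [C (maxn k n)], and the next thickening contains all points of [P k]
   close to it. *)
move=> k; rewrite -[X in closed X]setCK; apply: open_closedC.
rewrite openE => x; rewrite setCI setCK => -[[n _ Cx]|Px]; last first.
  suff : nbhs x (~` P k) by apply: filterS => y; right.
  by apply: open_nbhs_nbhs; split => //; exact: closed_openC.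
have [U U0 UC] := CU (maxn n k).
apply/nbhs_addl; apply: filterS U0 => u Uu /=.
have [Pxu|] := pselect (P k (x + u)); last by right.
left; exists (maxn n k).+1 => //; apply: UC => //.
  exact: (Cm n _ (leq_maxl _ _)).
by apply: Pmono Pxu; rewrite leqW// leq_maxr.
Qed.

Lemma exh_zero_base : zero_base [set U : set V |
  exists G, [/\ exh_closed (~` G), G 0 & G `<=` U]].
Proof.
split.
- by exists setT, setT; split => // n; rewrite setCT set0I; exact: closed0.
- move=> U W [G [Gcl G0 GU]] [H [Hcl H0 HW]]; exists (G `&` H);
    last exact: setISS.
  by exists (G `&` H); split => // n; rewrite setCI setIUl; exact: closedU.
- move=> U [G [Gcl G0 GU]].
  have [|H [Hcl H0 HG]] := exh_open_comb Gcl; first by apply.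
  exists H; first by exists H; split.
  by move=> a b u v a1 b1 Hu Hv; apply: GU; apply: contrapT; exact: HG.
- move=> U v [G [Gcl G0 GU]]; have [k Pv] := Pcover v.
  have N0 : nbhs 0 (~` (~` G `&` P k)).
    by apply: open_nbhs_nbhs; split; [exact: closed_openC|case].
  have [d d0 dN] := nbhs0_absorb v N0.
  (* The bound 1 keeps [a *: v] in [P k], where the neighbourhood found in [V] decides membership in
     [G]. *)
  exists (Num.min d 1); first by rewrite lt_min d0 ltr01.
  move=> a; rewrite le_min => /andP[ad a1]; apply: GU; apply: contrapT => Ga.
  by apply: (dN a ad); split => //; exact: Pbal.
Qed.

Lemma exh_closed_shift (F : set V) v : exh_closed F ->
  exh_closed [set u | F (v + u)].
Proof.
move=> Fcl n; have [k Pv] := Pcover v.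
have -> : [set u | F (v + u)] `&` P n =
    (fun u => v + u) @^-1` (F `&` P (k + n)%N) `&` P n.
  by apply/seteqP; split=> u /= [] => [Fu Pu|[Fu _] Pu]; do ?split => //;
      exact: Padd.
apply: closedI => //; apply: closed_comp => // u _.
exact: (tvs_cvgD (cvg_cst v) cvg_id).
Qed.

(** The limit topology is a vector topology for which [i] is continuous, so it is coarser than the
    free one. Translations preserve its closed sets, which reduces every point to the origin. *)
Lemma exh_closed_closed (X : topologicalType) (i : X -> V) (F : set V) :
  is_free_tvs i ->
  (forall G, exh_closed (~` G) -> G 0 -> forall x, nbhs x [set y | G (i y - i x)]) ->
  exh_closed F -> closed F.
Proof.
move=> Vfree HX Fcl; rewrite -[F]setCK; apply: open_closedC.
rewrite openE => v Fv; apply/nbhs_addl.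
apply: (free_nbhs0 Vfree exh_zero_base).
  move=> U [G [Gcl G0 GU]] x; apply: filterS (HX G Gcl G0 x) => y; exact: GU.
exists [set u | ~ F (v + u)]; split => //; last by rewrite /= addr0.
have := @exh_closed_shift F v Fcl; congr exh_closed.
by apply/seteqP; split=> u /=; rewrite notK.
Qed.

End exhaustion.

Section free_k_omega.
Context {R : realType} {X : topologicalType} {V : topologicalLmodType R}.
Context {i : X -> V}.
Hypotheses (Vfree : is_free_tvs i) (Xt : tychonoff_space X).
Variable K : nat -> set X.
Hypotheses (Kc : forall n, compact (K n)) (Kcover : \bigcup_n K n = setT).
Hypothesis Kcl : forall F : set X, (forall n, closed_in (K n) F) -> closed F.

Let Y n := \bigcup_(l in `I_n) K l.

Let Yc n : compact (Y n).
Proof.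
rewrite /Y -bigsetU_fset_set; last exact: finite_II.
by apply: bigsetU_compact.
Qed.

(** The admissible summands at stage [n]. Including 0 allows sums with fewer terms, so that the sets
    [P n] increase. *)
Let S n := [set 0] `|` [set a *: i y | a in [set a :
    R^o | `|a| <= n%:R] & y in Y n].

Fixpoint free_exh n : set V :=
  if n is m.+1 then [set u + v | u in free_exh m & v in S m] else [set 0].
Local Notation P := free_exh.

Let S0 n : S n 0. Proof. by left. Qed.

Let Smono n m : (n <= m)%N -> S n `<=` S m.
Proof.
move=> nm u [->|[a /= an [y [l ln Ky] <-]]]; first by left.
right; exists a; first by rewrite /= (le_trans an)// ler_nat.
by exists y => //; exists l => //; exact: leq_trans nm.
Qed.

Let P0 n : P n 0.
Proof. by elim: n => [//|n IH]/=; exists 0 => //; exists 0 => //;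
    rewrite addr0. Qed.

Let PS n : S n `<=` P n.+1.
Proof. by move=> u Su; exists 0 => //; exists u => //; rewrite add0r. Qed.

Let Pmono n m : (n <= m)%N -> P n `<=` P m.
Proof.
elim: m => [|m IH]; first by rewrite leqn0 => /eqP ->.
rewrite leq_eqVlt => /orP[/eqP -> //|/IH nm] u /nm Pu.
by exists u => //; exists 0 => //; rewrite addr0.
Qed.

Let Padd n m u v : P n u -> P m v -> P (n + m)%N (u + v).
Proof.
move=> Pu; elim: m v => [|m IH] v; first by move=> ->; rewrite addn0 addr0.
move=> [w /IH Pw [s Ss <-]]; rewrite addnS addrA.
by exists (u + w) => //; exists s => //; apply: Smono Ss; rewrite leq_addl.
Qed.

Let Pbal n a u : `|a| <= 1 -> P n u -> P n (a *: u).
Proof.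
move=> a1; elim: n u => [|n IH] u; first by move=> ->; rewrite scaler0.
move=> [w /IH Pw [s Ss <-]]; rewrite scalerDr; exists (a *: w) => //.
exists (a *: s) => //; case: Ss => [->|[b /= bn [y Yy <-]]].
  by rewrite scaler0; left.
right; exists (a * b); last by exists y => //; rewrite scalerA.
by rewrite /= normrM (le_trans _ bn)// ler_piMl.
Qed.

Let Pc n : compact (P n).
Proof.
elim: n => [|n IH] /=; first exact: compact_set1.
have Sc : compact (S n).
  apply: compactU; first exact: compact_set1.
  rewrite (_ : [set _ | _ in _ & _ in _] = (fun z : R^o * X => z.1 *: i z.2) @`
      ([set a : R^o | `|a| <= n%:R] `*` Y n)); last first.
    apply/seteqP; split=> [_ [a an [y Yy <-]]|_ [[a y] [/= an Yy] <-]].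
      by exists (a, y).
    by exists a => //; exists y.
  apply: continuous_compact.
    apply: continuous_subspaceT => -[a y] /=.
    apply: (tvs_cvgZ cvg_fst).
    exact: (cvg_comp snd i cvg_snd (@free_continuous _ _ _ _ Vfree y)).
  by apply: compact_setX => //; exact: itv_compact.
rewrite (_ : [set _ | _ in _ & _ in _] = (fun z : V * V => z.1 + z.2) @`
    (P n `*` S n)); last first.
  apply/seteqP; split=> [_ [u Pu [v Sv <-]]|_ [[u v] [/= Pu Sv] <-]].
    by exists (u, v).
  by exists u => //; exists v.
apply: continuous_compact; last exact: compact_setX.
by apply: continuous_subspaceT; exact: (@tvs.add_continuous V).
Qed.

Let PZ a n : exists m, forall u, P n u -> P m (a *: u).
Proof.
elim: n => [|n [m mP]]; first by exists 0%N => u ->; rewrite scaler0.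
(* [k] bounds the scaled coefficient [|a| * n]; the maximum with [n] keeps the points inside the
   same union of compacts. *)
pose k := (Num.truncn (`|a| * n%:R)).+1.
exists (m + (maxn k n).+1)%N => _ [u /mP Pu [s Ss <-]].
rewrite scalerDr; apply: Padd => //; apply: PS.
case: Ss => [->|[b /= bn [y [l ln Ky] <-]]]; first by rewrite scaler0; left.
right; exists (a * b); last first.
  exists y; last by rewrite scalerA.
  by exists l => //=; rewrite (leq_trans ln)// leq_maxr.
rewrite /= normrM (le_trans (ler_wpM2l _ bn))//.
by rewrite (le_trans (ltW (truncnS_gt _)))// ler_nat leq_maxl.
Qed.

Let Pi n : exists m, forall x, K n x -> P m (i x).
Proof.
(* [K n] is contained in [Y n.+1], since [Y] stops before its index, and [S n.+1] is contained in
   [P n.+2]. *)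
exists n.+2 => x Kx; apply: PS; right; exists 1; first
    by rewrite /= normr1 ler1n.
by exists x; [exists n => /=|rewrite scale1r].
Qed.

Let Pcover v : exists n, P n v.
Proof.
move: v; apply: (free_ind Vfree).
- by exists 0%N.
- move=> a u v [n Pu] [m Pv]; have [k kP] := PZ a n.
  by exists (k + m)%N; apply: Padd => //; exact: kP.
- move=> x; have : (\bigcup_n K n) x by rewrite Kcover.
  by move=> [n _ Kx]; have [m mP] := Pi n; exists m; exact: mP.
Qed.

(** Continuity of [i] for the limit topology is tested on each [K n]: there [i y - i x] stays in a
    single [P (m + k)], on which the complement of [G] is closed. *)
Lemma free_k_omega : k_omega_space V.
Proof.
have Vh := free_hausdorff Vfree Xt.
exists P; split => //.
  by rewrite -subTset => v _; have [n Pv] := Pcover v; exists n.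
move=> F FP;
    apply: (exh_closed_closed Vh Pc (P0 0) Pmono Padd Pbal Pcover Vfree).
  move=> G Gcl G0 x.
  suff H : closed [set y | ~ G (i y - i x)].
    have : open [set y | G (i y - i x)].
      by rewrite -[X in open X]setCK; exact: closed_openC.
    by move=> oG; apply: open_nbhs_nbhs; split => //=; rewrite subrr.
  apply: Kcl => n; have [m mP] := Pi n; have [k kP] := Pcover (- i x).
  apply/closed_subspaceP.
  exists ((fun y => i y - i x) @^-1` (~` G `&` P (m + k)%N)).
    apply: closed_comp => // y _.
    exact: (tvs_cvgB (@free_continuous _ _ _ _ Vfree y) (cvg_cst (i x))).
  rewrite -setIA setIid; apply/seteqP; split=> y /= [].
    by move=> [Gy _] Ky.
  by move=> Gy Ky; split=> //; split => //; apply: Padd => //; exact: mP.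
move=> n; have /closed_subspaceP[D Dcl] := FP n.
rewrite -setIA setIid => <-; apply: closedI => //; exact: compact_closed.
Qed.

End free_k_omega.

(** * Fan vectors *)

(** From functions [u j] with [u j (xi l)] the Kronecker delta, take the positive part of [u j]
    minus the sum of the others. It is nonzero only where [u j] exceeds that sum, which happens for
    at most one [j]. *)
Lemma disjoint_bumps (R : realType) (X : topologicalType) (xi : nat -> X) n :
  tychonoff_space X -> injective xi ->
  exists phi : 'I_n -> X -> R, [/\ forall j, continuous (phi j),
    forall j x, 0 <= phi j x <= 1, forall j, phi j (xi j) = 1 &
    forall j l x, j != l -> phi j x != 0 -> phi l x = 0].
Proof.
move=> Xt xi_inj.
have H (j : 'I_n) : exists u : X -> R, [/\ continuous u,
    forall x, 0 <= u x <= 1, u (xi j) = 1 & forall l :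
        'I_n, l != j -> u (xi l) = 0].
  have [|u [cu u01 u0 u1]] :=
      @tychonoff_sep1 R X (xi j) [seq xi (nat_of_ord l) | l <- rem j (enum 'I_n)] Xt.
    apply/mapP => -[l]; rewrite mem_rem_uniq ?enum_uniq// inE => /andP[lj _].
    by move=> /xi_inj/val_inj jl; rewrite jl eqxx in lj.
  exists u; split => // l lj; apply: u0; apply: map_f.
  by rewrite mem_rem_uniq ?enum_uniq// inE lj mem_enum.
have [u uP] := choice H.
have u0 j x : 0 <= u j x by have [_ /(_ x)/andP[]] := uP j.
have ule j x : u j x <= 1 by have [_ /(_ x)/andP[]] := uP j.
have usum j x : u j x <= \sum_l u l x.
  by rewrite (bigD1 j)//= lerDl sumr_ge0.
pose phi j x := Num.max 0 (2 * u j x - \sum_l u l x).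
have phi_pos j x : phi j x != 0 -> \sum_l u l x < 2 * u j x.
  by move=> px; rewrite -subr_gt0 ltNge; apply: contra px => h;
      rewrite /phi max_l.
exists phi; split.
- move=> j; apply: (@max_fun_continuous _ X R (fun=> 0)) => x;
    first exact: cvg_cst.
  apply: cvgB; first by apply: cvgM; [exact: cvg_cst|have [+ _ _ _] := uP j;
      exact].
  apply: (@cvg_big R^o _ _ _ _ (@tvs.add_continuous R^o)) => l _.
  by have [+ _ _ _] := uP l; exact.
- move=> j x; rewrite /phi le_max lexx/= ge_max ler01/=.
  by have := usum j x; have := ule j x; lra.
- move=> j; have [_ _ u1 _] := uP j.
  rewrite /phi (bigD1 j)//= u1 big1 ?addr0.
    by rewrite (_ : 2 * 1 - 1 = 1 :> R) ?max_r ?ler01//; lra.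
  by move=> l lj; have [_ _ _] := uP l; apply; rewrite eq_sym.
- move=> j l x jl /phi_pos jx; apply/eqP; apply: contraT => /phi_pos lx.
  have : u j x + u l x <= \sum_l u l x.
    rewrite (bigD1 j)//= lerD2l (bigD1 l) 1?eq_sym//= lerDl.
    by rewrite sumr_ge0.
  by move: jx lx; lra.
Qed.

Section fan.
Context {R : realType} {X : topologicalType} {V : topologicalLmodType R}.
Context {i : X -> V}.
Hypotheses (Vfree : is_free_tvs i) (Xt : tychonoff_space X).
Local Notation ext := (ext Vfree).
Variable xi : nat -> X.
Hypothesis xi_inj : injective xi.

Definition fan_vec n : V := \sum_(j < n.+1) i (xi j).

Section fan_gauge.
Variable mu : nat -> R.
Hypothesis mu_gt0 : forall n, 0 < mu n.
Variable phi : forall n, 'I_n.+1 -> X -> R.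
Hypothesis phi_cont : forall n j, continuous (@phi n j).
Hypothesis phi01 : forall n j x, 0 <= @phi n j x <= 1.
Hypothesis phi_xi : forall n j, @phi n j (xi j) = 1.
Hypothesis phi_disj :
    forall n j l x, j != l -> @phi n j x != 0 -> @phi n l x = 0.

(* An L^0-type gauge: since at most one [phi j x] is nonzero for each [x], a
   multiple of a point has size at most [1 / (n + 1)]. *)
Let p n (v : V) : R :=
  n.+1%:R^-1 * \sum_(j < n.+1) Num.min 1 (mu n * `|ext (phi j) v|).

Let p_comb n (a b : R) u v : `|a| <= 1 -> `|b| <= 1 ->
  p n (a *: u + b *: v) <= p n u + p n v.
Proof.
move=> a1 b1; rewrite -mulrDr ler_wpM2l// -big_split/=; apply: ler_sum => j _.
rewrite extD// !extZ//.
set x := ext _ u; set y := ext _ v.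
have m0 := mu_gt0 n.
have xy : mu n * `|a * x + b * y| <= mu n * `|x| + mu n * `|y|.
  rewrite -mulrDr ler_wpM2l ?(ltW m0)// (le_trans (ler_normD _ _))// !normrM.
  by rewrite lerD// ler_piMl.
have x0 : 0 <= mu n * `|x| by rewrite mulr_ge0// ltW.
have y0 : 0 <= mu n * `|y| by rewrite mulr_ge0// ltW.
move: xy; set A := mu n * `|_|; move=> xy.
move: x0 y0 xy; move: (mu n * `|x|) (mu n * `|y|) => s t s0 t0 st.
by rewrite /Num.min; case: ltP => ?; case: ltP => ?; case: ltP => ?; lra.
Qed.

Let p_point n (a : R) x :
    p n (a *: i x) <= n.+1%:R^-1 * Num.min 1 (mu n * `|a|).
Proof.
rewrite ler_wpM2l//.
have e j : Num.min 1 (mu n * `|ext (@phi n j) (a *: i x)|) =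
    Num.min 1 (mu n * (`|a| * phi j x)).
  have /andP[f0 _] := phi01 j x.
  by rewrite extZ// extE// normrM (ger0_norm f0).
under eq_bigr do rewrite e.
have [[j jx]|nj] := pselect (exists j, @phi n j x != 0).
  rewrite (bigD1 j)//= big1 ?addr0 => [|l lj]; last first.
    rewrite (phi_disj (j := j) (l := l))// 1?eq_sym// !mulr0.
    by rewrite min_r.
  have /andP[f0 f1] := phi01 j x.
  have : mu n * (`|a| * phi j x) <= mu n * `|a|.
    by rewrite ler_wpM2l ?(ltW (mu_gt0 n))// ler_piMr.
  by rewrite le_min !ge_min lexx/= => ->; rewrite orbT.
rewrite big1; first by rewrite le_min ler01 mulr_ge0// ltW.
move=> j _; have [->|/eqP jx] := eqVneq (phi j x) 0; last first.
  by exfalso; apply: nj; exists j; apply/eqP.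
by rewrite !mulr0 min_r.
Qed.

Let p_point_le n (a : R) x : p n (a *: i x) <= n.+1%:R^-1.
Proof.
by rewrite (le_trans (p_point _ _ _))// ler_piMr// ge_min lexx.
Qed.

Let p_point_mu n (a : R) x : p n (a *: i x) <= mu n * `|a|.
Proof.
rewrite (le_trans (p_point _ _ _))//.
have h : Num.min 1 (mu n * `|a|) <= mu n * `|a| by rewrite ge_min lexx orbT.
rewrite (le_trans _ h)// ler_piMl//.
  by rewrite le_min ler01 mulr_ge0// ltW.
by rewrite invf_le1// ler1n.
Qed.

Let p0 n : p n 0 = 0.
Proof.
rewrite /p big1 ?mulr0// => j _.
by rewrite ext0// normr0 mulr0 min_r.
Qed.

Let p_scale n (a : R) v : `|a| <= 1 -> p n (a *: v) <= p n v.
Proof.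
by move=> a1; have := @p_comb n a 0 v 0 a1; rewrite normr0 scaler0 p0 !addr0;
    exact.
Qed.

Let p_add n u v : p n (u + v) <= p n u + p n v.
Proof.
by have := @p_comb n 1 1 u v; rewrite !scale1r normr1; apply.
Qed.

Let p_seq n (s : seq (R * X)) :
  p n (\sum_(q <- s) q.1 *: i q.2) <= (size s)%:R / n.+1%:R.
Proof.
elim: s => [|q s IH]; first by rewrite big_nil p0 mul0r.
rewrite big_cons (le_trans (p_add _ _ _))//= -natr1 mulrDl mul1r addrC.
exact: lerD.
Qed.

Let p_fan n : p n ((mu n)^-1 *: fan_vec n) = 1.
Proof.
rewrite /p (eq_bigr (fun=> 1)) => [|j _].
  by rewrite sumr_const card_ord mulVf// pnatr_eq0.
rewrite extZ// (ext_sum)// (bigD1 j)//= extE// phi_xi big1 ?addr0.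
  by rewrite mulr1 gtr0_norm ?invr_gt0// mulfV ?gt_eqF// minxx.
move=> l lj; rewrite extE//; apply: (phi_disj (j := l)); first by [].
by rewrite phi_xi oner_eq0.
Qed.

Let base : set (set V) := [set [set v | forall n, p n v <= e] | e in [set e :
    R | 0 < e]].

Let pick_N (e : R) : 0 < e -> exists N, forall n, (N <= n)%N -> n.+1%:R^-1 <= e.
Proof.
move=> e0; exists (Num.truncn e^-1) => n Nn.
rewrite invf_ple ?posrE// (le_trans (ltW (truncnS_gt _)))// ler_nat ltnS.
exact: Nn.
Qed.

Let base_absorb v (e : R) : 0 < e ->
  exists2 d : R, 0 < d & forall a, `|a| <= d -> forall n, p n (a *: v) <= e.
Proof.
move: v e; apply: (free_ind Vfree).
- by move=> e e0; exists 1 => // a _ n; rewrite scaler0 p0 ltW.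
- move=> c u v Hu Hv e e0; have e20 : 0 < e / 2 by rewrite divr_gt0.
  have [d d0 dH] := Hu _ e20; have [d' d'0 d'H] := Hv _ e20.
  have c0 : 0 < `|c| + 1 by rewrite ltr_wpDl.
  exists (Num.min (d / (`|c| + 1)) d'); first by rewrite lt_min divr_gt0.
  move=> a; rewrite le_min => /andP[ad ad'] n.
  rewrite scalerDr scalerA (le_trans (p_add _ _ _))// (splitr e) lerD//;
      last exact: d'H.
  apply: dH; rewrite normrM; rewrite ler_pdivlMr// in ad.
  by rewrite (le_trans _ ad)// ler_wpM2l// lerDl.
- move=> x e e0; have [N NP] := pick_N e0.
  (* For [n >= N] a multiple of a point is small for every scalar; the finitely many remaining
     gauges are controlled by [mu n * |a|], and [s] dominates all these [mu n]. *)
  pose s := \sum_(n < N) mu n.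
  have s0 : 0 < s + 1 by rewrite ltr_wpDl// sumr_ge0// => n _; exact: ltW.
  exists (e / (s + 1)); first by rewrite divr_gt0.
  move=> a ad n; have [nN|Nn] := ltnP n N;
      last exact: (le_trans (p_point_le _ _ _) (NP _ Nn)).
  rewrite (le_trans (p_point_mu _ _ _))//
      (le_trans (ler_wpM2l _ ad)) ?(ltW (mu_gt0 n))//.
  rewrite mulrA ler_pdivrMr// mulrC ler_wpM2l ?(ltW e0)//.
  rewrite /s (bigD1 (Ordinal nN))//= -addrA lerDl addr_ge0//.
  by rewrite sumr_ge0// => l _; exact: ltW.
Qed.

Let base_point x (e : R) : 0 < e ->
  nbhs x [set y | forall n, p n (i y - i x) <= e].
Proof.
move=> e0; have [N NP] : exists N, forall n, (N <= n)%N -> n.+1%:R^-1 <= e / 2.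
  by apply: pick_N; rewrite divr_gt0.
have sub y : i y - i x = 1 *: i y + (-1) *: i x by rewrite scale1r scaleN1r.
(* From [N] on, the two points contribute at most [e / 2] each; below [N] only finitely many
   continuous functions [phi j] are involved. *)
have near_phi : \forall y \near x, forall (n : 'I_N) (j : 'I_n.+1),
    `|phi j y - phi j x| <= e / mu n.
  apply: filter_forall => n; apply: filter_forall => j.
  have d0 : 0 < e / mu n by rewrite divr_gt0.
  have := @phi_cont n j x; move=> /(@cvgrPdist_le R R^o)/(_ _ d0).
  by apply: filterS => y; rewrite distrC.
apply: filterS near_phi => y yP n; have [nN|Nn] := ltnP n N; last first.
  rewrite sub (le_trans (p_add _ _ _))// (splitr e).
  by rewrite lerD// (le_trans (p_point_le _ _ _))// NP.
rewrite /p mulrC ler_pdivrMr//.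
have -> : e * n.+1%:R = \sum_(j < n.+1) e
    by rewrite sumr_const card_ord mulr_natr.
apply: ler_sum => j _; rewrite extB// !extE// ge_min; apply/orP; right.
by have := yP (Ordinal nN) j; rewrite /= ler_pdivlMr// mulrC.
Qed.

Let base_zero_base : zero_base base.
Proof.
split.
- by exists [set v | forall n, p n v <= 1]; exists 1 => //=.
- move=> _ _ [e /= e0 <-] [d /= d0 <-].
  exists [set v | forall n, p n v <= Num.min e d].
    by exists (Num.min e d) => //=; rewrite lt_min e0.
  by move=> v ved; split=> n; have := ved n; rewrite le_min => /andP[].
- move=> _ [e /= e0 <-]; exists [set v | forall n, p n v <= e / 2].
    by exists (e / 2) => //=; rewrite divr_gt0.
  move=> a b u v a1 b1 ue ve n; rewrite (le_trans (p_comb n u v a1 b1))//.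
  by rewrite (splitr e) lerD.
- by move=> _ v [e /= e0 <-]; exact: base_absorb.
Qed.

Let fan_gauge : nbhs 0 [set v : V | forall n, p n v <= 2^-1].
Proof.
apply: (free_nbhs0 Vfree base_zero_base).
  by move=> _ [e /= e0 <-] x; exact: base_point.
by exists 2^-1 => //=.
Qed.

(** The fan term has gauge 1 and the sum at most 1/2, so the combination has gauge at least 1/2;
    with [size s] terms it is at most [size s / (n + 1)]. *)
Lemma fan_nbhs_gauge : exists2 U : set V, nbhs 0 U &
  forall n (s : seq (R * X)),
    U (\sum_(q <- s) q.1 *: i q.2 + (mu n)^-1 *: fan_vec n) ->
    (n.+1 <= (size s).*2)%N.
Proof.
exists [set v : V | forall n, p n v <= 2^-1]; first exact: fan_gauge.
move=> n s /(_ n) /= Us; set w := \sum_(q <- s) _ in Us.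
have : p n ((mu n)^-1 *: fan_vec n) <=
    p n (w + (mu n)^-1 *: fan_vec n) + p n w.
  rewrite -[in X in p n X <= _](addKr w (_ *: fan_vec n)) addrC.
  rewrite (le_trans (p_add _ _ _))// lerD2l -scaleN1r p_scale//.
  by rewrite normrN normr1.
rewrite p_fan => H.
have {}H : 2^-1 <= (size s)%:R / n.+1%:R :> R.
  move: (p_seq n s) H Us; rewrite -/w.
  by move: (p n w) (p n (w + _)) (_ / _) => a b c; lra.
rewrite ler_pdivlMr// mulrC ler_pdivrMr// -natrM ler_nat in H.
by rewrite -muln2.
Qed.

End fan_gauge.

Lemma fan_nbhs (mu : nat -> R) : (forall n, 0 < mu n) ->
  exists2 U : set V, nbhs 0 U &
  forall n (s : seq (R * X)),
    U (\sum_(q <- s) q.1 *: i q.2 + (mu n)^-1 *: fan_vec n) ->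
    (n.+1 <= (size s).*2)%N.
Proof.
move=> mu0; have H n := @disjoint_bumps R X xi n.+1 Xt xi_inj.
pose phi n := projT1 (cid (H n)).
have phiP n := projT2 (cid (H n)).
apply: (@fan_nbhs_gauge mu mu0 phi).
- by move=> n; have [+ _ _ _] := phiP n.
- by move=> n; have [_ + _ _] := phiP n.
- by move=> n; have [_ _ + _] := phiP n.
- by move=> n; have [_ _ _ +] := phiP n.
Qed.

Lemma ext_fan_vec (phi : X -> R) n : continuous phi ->
  (forall x, 0 <= phi x <= 1) -> 0 <= ext phi (fan_vec n) <= n.+1%:R.
Proof.
move=> cphi phi01; rewrite ext_sum//.
rewrite (eq_bigr (fun j : 'I_n.+1 => phi (xi j))) => [|j _]; last
    by rewrite extE.
apply/andP; split; first by apply: sumr_ge0 => j _; have /andP[] :=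
    phi01 (xi j).
rewrite -[n.+1 in X in _ <= X]card_ord -sumr_const.
by apply: ler_sum => j _; have /andP[] := phi01 (xi j).
Qed.

Lemma ext_fan_vec1 n : ext (cst 1) (fan_vec n) = n.+1%:R.
Proof.
have c1 : continuous (cst 1 : X -> R) by move=> x; exact: cvg_cst.
rewrite ext_sum// (eq_bigr (fun=> 1)) => [|j _]; last by rewrite extE.
by rewrite sumr_const card_ord.
Qed.

End fan.

(** * The obstruction derived from the k-space property *)

Section fan_obstruction.
Context {R : realType} {X : topologicalType} {V : topologicalLmodType R}.
Context {i : X -> V}.
Hypotheses (Vfree : is_free_tvs i) (Xt : tychonoff_space X) (Vk : k_space V).
Local Notation ext := (ext Vfree).
Variable xi : nat -> X.
Hypothesis xi_inj : injective xi.

(** [m t] is a level, along which the vectors [w t] tend weakly to 0; [k t] is a further index that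
    decides how small a fan multiple is added within a level. *)
Variables (T : Type) (m k : T -> nat) (w : T -> V) (r : nat).
Hypothesis w_fin : forall n (K : set V), compact K ->
  finite_set [set t | m t = n /\ K (w t)].
Hypothesis w_span : forall t, exists s : seq (R * X),
  (size s <= r)%N /\ w t = \sum_(q <- s) q.1 *: i q.2.
Hypothesis w_ext0 : forall phi : X -> R, continuous phi ->
  (forall x, 0 <= phi x <= 1) -> forall e : R, 0 < e ->
  exists N, forall t, (N <= m t)%N -> `|ext phi (w t)| <= e.
Hypothesis w_ext1 : forall t, 0 <= ext (cst 1) (w t).

Local Notation z := (@fan_vec R X V i xi).

(** The square makes the fan term weakly at most [1 / (m t + 1)], as functionals of [0,1]-valued
    functions are at most [m t + 1] on it; the other factor makes it small at a fixed level when
    [k t] is large. *)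
Let mu t : R := (m t).+1%:R ^+ 2 * (k t).+1%:R.
Let a t : V := w t + (mu t)^-1 *: z (m t).

Let mu_gt0 t : 0 < mu t.
Proof. by rewrite mulr_gt0// exprn_gt0. Qed.

Let mu_ge1 t : 1 <= mu t.
Proof. by rewrite -[1]mulr1 ler_pM// ?ler1n// -natrX ler1n expn_gt0. Qed.

Let a_fin n (K : set V) : compact K -> finite_set [set t | m t = n /\ K (a t)].
Proof.
move=> Kc; pose K' := (fun q : V * R^o => q.1 - q.2 *: z n) @`
  (K `*` [set b : R^o | `|b| <= 1]).
have K'c : compact K'.
  apply: continuous_compact; last first.
    by apply: compact_setX => //; exact: itv_compact.
  apply: continuous_subspaceT => -[u b] /=.
  apply: tvs_cvgB; first exact: cvg_fst.
  exact: (tvs_cvgZ cvg_snd (cvg_cst (z n))).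
apply: sub_finite_set (w_fin n K'c) => t [/= tn Kt]; split => //.
exists (a t, (mu t)^-1); last by rewrite /= /a tn addrK.
by split => //=; rewrite gtr0_norm ?invr_gt0// invf_le1.
Qed.

Let ext_a_small (phi : X -> R) : continuous phi ->
  (forall x, 0 <= phi x <= 1) -> forall e : R, 0 < e ->
  exists N, forall t, (N <= m t)%N -> `|ext phi (a t)| <= e.
Proof.
move=> cphi phi01 e e0; have e20 : 0 < e / 2 by rewrite divr_gt0.
have [N NP] := w_ext0 cphi phi01 e20.
exists (maxn N (Num.truncn (e / 2)^-1)) => t; rewrite geq_max => /andP[/NP wt].
move=> et; rewrite extD// extZ// (le_trans (ler_normD _ _))// (splitr e).
rewrite lerD//; have /andP[z0 z1] := ext_fan_vec Vfree xi (m t) cphi phi01.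
rewrite normrM (ger0_norm z0) gtr0_norm ?invr_gt0//.
have mt0 : 0 < (m t).+1%:R :> R by [].
apply: (@le_trans _ _ (m t).+1%:R^-1).
  rewrite mulrC ler_pdivrMr// (le_trans z1)// /mu expr2 -mulrA mulKf ?gt_eqF//.
  by rewrite ler_peMr// ler1n.
rewrite invf_ple ?posrE// (le_trans (ltW (truncnS_gt _)))// ler_nat ltnS.
exact: et.
Qed.

(** Each level contributes finitely many [t]. If infinitely many levels occurred, one [t] per level
    would give vectors clustering in [K] at a point where all functionals vanish, that is at 0; but
    [fan_nbhs] keeps these vectors away from 0 from level [r.*2] on. *)
Let a_compact_fin (K : set V) : compact K -> finite_set [set t | K (a t)].
Proof.
move=> Kc; have [[N NP]|nN] :=
    pselect (exists N, forall t, K (a t) -> (m t < N)%N).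
  suff -> :
      [set t | K (a t)] = \bigcup_(n in `I_N) [set t | m t = n /\ K (a t)].
    by apply: bigcup_finite => [|n _]; [exact: finite_II|exact: a_fin].
  apply/seteqP; split=> [t Kt|t [n _ [_ Kt]]] //.
  by exists (m t) => //=; exact: NP.
exfalso.
pose I := [set n | exists t, m t = n /\ K (a t)].
have Iinf N : exists2 n, (N <= n)%N & I n.
  apply: contrapT => nI; apply: nN; exists N => t Kt; rewrite ltnNge.
  by apply/negP => Nt; apply: nI; exists (m t) => //; exists t.
have [t0 _] : exists t0 : T, True.
  by have [n _ [t _]] := Iinf 0%N; exists t.
have /choice[tau tauP] n : exists t, I n -> m t = n /\ K (a t).
  have [[t tP]|nI] := pselect (I n); last by exists t0.
  by exists t.
have [U U0 UP] := @fan_nbhs R X V i Vfree Xt xi xi_inj (mu \o tau)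
  (fun n => mu_gt0 (tau n)).
pose F : set_system V :=
    [set A | exists N, forall n, (N <= n)%N -> I n -> A (a (tau n))].
have FP : ProperFilter F.
  split.
    by move=> [N NP]; have [n Nn In] := Iinf N; exact: (NP n).
  split.
  - by exists 0%N.
  - move=> A B [N NP] [M MP]; exists (maxn N M) => n.
    by rewrite geq_max => /andP[/NP ? /MP ?] In; split; auto.
  - by move=> A B AB [N NP]; exists N => n Nn In; exact/AB/NP.
have [v [Kv vF]] : K `&` cluster F !=set0.
  by apply: Kc; exists 0%N => n _ /tauP[].
have v0 : v = 0.
  apply: (@ext_eq0 _ _ _ _ Vfree Xt v) => phi cphi phi01; apply/eqP;
      rewrite -normr_eq0.
  rewrite eq_le normr_ge0 andbT; apply/ler_addgt0Pl => e e0; rewrite addr0.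
  have [N NP] := ext_a_small cphi phi01 e0.
  rewrite leNgt; apply/negP => ev.
  have ne : nbhs v [set u | e < `|ext phi u|].
    have ne : nbhs (ext phi v : R^o) [set x : R^o | e < `|x|].
      apply: open_nbhs_nbhs; split => //.
      by apply: (@open_comp R^o R^o Num.norm [set x | e < x]); [move=> ? _;
          exact: norm_continuous|exact: open_gt].
    exact: (ext_continuous cphi ne).
  have FN : F [set u | `|ext phi u| <= e].
    by exists N => n Nn /tauP[mn _]; apply: NP; rewrite mn.
  by have [u [/= + eu]] := vF _ _ FN ne; rewrite leNgt eu.
have FU : F (~` U).
  exists r.*2 => n rn /tauP[mn _] Ua; have [s [sr ws]] := w_span (tau n).
  rewrite /a mn ws in Ua; have ns := UP n s Ua.
  by have := leq_trans ns (leq_trans _ rn); rewrite leq_double ltnn => /(_ sr).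
by rewrite v0 in vF; have [u []] := vF _ _ FU U0.
Qed.

(** The set of all [a t] is closed and misses 0, so a neighbourhood of 0 avoids it. If [w t] is
    small and [k t] is large for its level, the fan term is small too, and [a t] would lie in that
    neighbourhood. *)
Lemma fan_obstruction : exists (U : set V) (kappa : nat -> nat),
  nbhs 0 U /\ forall t, U (w t) -> (k t < kappa (m t))%N.
Proof.
have Acl : closed (range a).
  apply: Vk => K Kc; apply: closed_subspaceW; apply: compact_closed.
    exact: (free_hausdorff Vfree Xt).
  apply: finite_compact.
  rewrite (_ : _ `&` _ = a @` [set t | K (a t)]);
      first exact/finite_image/a_compact_fin.
  by apply/seteqP; split=> [_ [[t _ <-] Kt]|_ [t Kt <-]]; [exists t|split =>
      //; exists t].
have c1 : continuous (cst 1 : X -> R) by move=> x; exact: cvg_cst.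
have A0 : nbhs 0 (~` range a).
  apply: open_nbhs_nbhs; split; first exact: closed_openC.
  (* The total mass separates [a t] from 0: it is nonnegative on [w t] and positive on the fan
     term. *)
  move=> [t _] /(congr1 (ext (cst 1))); rewrite ext0// extD// extZ//
      ext_fan_vec1.
  have h : 0 < (mu t)^-1 * (m t).+1%:R by rewrite mulr_gt0 ?invr_gt0.
  by have := w_ext1 t; lra.
have [W W0 WA] := nbhs0_comb A0.
have /choice[kappa kappaP] n : exists N, forall c : R,
    `|c| <= N.+1%:R^-1 -> W (c *: z n).
  have [d d0 dW] := nbhs0_absorb (z n) W0.
  exists (Num.truncn d^-1) => c cN; apply: dW; rewrite (le_trans cN)//.
  by rewrite invf_ple ?posrE// (le_trans (ltW (truncnS_gt _))).
exists W, kappa; split => // t Wt; rewrite ltnNge; apply/negP => kt.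
have := WA 1 1 (w t) ((mu t)^-1 *: z (m t)); rewrite normr1 !scale1r.
move=> /(_ (lexx _) (lexx _) Wt); apply; last by exists t.
apply: kappaP; rewrite gtr0_norm ?invr_gt0// lef_pV2 ?posrE// /mu.
rewrite -[leLHS]mul1r ler_pM// ?ler_nat// -natrX ler1n expn_gt0//.
Qed.

End fan_obstruction.

(** * Infinite and uncountable sets *)

Lemma infinite_inj_seq (T : Type) (A : set T) : infinite_set A ->
  exists d : nat -> T, injective d /\ forall n, A (d n).
Proof.
move=> /infiniteP/card_leP[f].
have nT (n : nat) : n \in [set: nat] by rewrite inE.
exists (fun n => val (f (SigSub (nT n)))); split=> [n m /val_inj fnm|n].
  have /(congr1 val) // : SigSub (nT n) = SigSub (nT m).
  by apply: (@inj _ _ _ f); rewrite ?inE.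
exact: set_valP.
Qed.

Section branch.
Context {T : Type} (h : T -> nat -> bool).

Definition diff_index (f g : nat -> bool) : nat :=
  if pselect (exists n, f n != g n) is left e then ex_minn e else 0%N.

Lemma diff_index_unique f g n : f n != g n ->
  (forall l, (l < n)%N -> f l = g l) -> diff_index f g = n.
Proof.
move=> fgn fgl; rewrite /diff_index; case: pselect => [e|]; last by case;
    exists n.
case: ex_minnP => l fgl' lmin; apply/eqP; rewrite eqn_leq lmin//= leqNgt.
by apply/negP => /fgl fgE; rewrite fgE eqxx in fgl'.
Qed.

Lemma diff_indexP f g : f <> g ->
  f (diff_index f g) != g (diff_index f g) /\
  forall l, (l < diff_index f g)%N -> f l = g l.
Proof.
move=> fg; rewrite /diff_index; case: pselect => [e|ne].
  case: ex_minnP => n fgn nmin; split => // l ln; apply/eqP; apply: contraTT ln.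
  by rewrite -leqNgt; exact: nmin.
exfalso; apply: fg; apply/funext => n; apply: contrapT => /eqP fgn.
by apply: ne; exists n.
Qed.

Lemma diff_index_ge f g n : f <> g -> (forall l, (l < n)%N -> f l = g l) ->
  (n <= diff_index f g)%N.
Proof.
move=> /diff_indexP[fgn _] fgl; rewrite leqNgt; apply/negP => /fgl fgE.
by rewrite fgE eqxx in fgn.
Qed.

(** König's argument: at each level keep a bit that infinitely many of the remaining elements
    share. *)
Lemma infinite_branch (A : set T) : infinite_set A ->
  exists c : nat -> bool, forall n,
    infinite_set [set x | A x /\ forall l, (l < n)%N -> h x l = c l].
Proof.
move=> Ainf.
have /choice[g gP] (p : nat * set T) : exists b, infinite_set p.2 ->
    infinite_set (p.2 `&` [set x | h x p.1 = b]).
  have [fin|inf] := pselect (finite_set (p.2 `&` [set x | h x p.1 = true])).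
    exists false => pinf fin'; apply: pinf.
    rewrite (_ : p.2 = (p.2 `&` [set x | h x p.1 = true]) `|`
                       (p.2 `&` [set x | h x p.1 = false])).
      by rewrite finite_setU.
    rewrite -setIUr; apply/esym/setIidPl => x _ /=.
    by case: (h x p.1); [left|right].
  by exists true.
pose B := fix B n := if n is m.+1 then
  B m `&` [set x | h x m = g (m, B m)] else A.
have Binf n : infinite_set (B n) by elim: n => //= n /(gP (n, B n)).
exists (fun n => g (n, B n)) => n; rewrite (_ : [set _ | _] = B n)//.
apply/seteqP; split=> x.
  move=> [Ax]; elim: n => [//|n IH hx]; split; last exact: hx.
  by apply: IH => l ln; apply: hx; exact: leqW.
elim: n => [//|n IH [/IH [Ax hx] hxn]]; split => // l.
by rewrite ltnS leq_eqVlt => /orP[/eqP ->//|/hx].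
Qed.

(** Along an infinite branch [c], let [x] leave [c] at some [m >= N], and let distinct [y], [z]
    follow [c] beyond [m] and up to [kappa m]. Then [x], [y] split exactly at [m], and [y], [z] not
    before [kappa m]. *)
Lemma branch_triple (A : set T) (N : nat) (kappa : nat -> nat) :
  infinite_set A -> (forall x y, A x -> A y -> h x = h y -> x = y) ->
  exists x y z, [/\ A x, A y, A z, h x <> h y /\ h y <> h z &
    (N <= diff_index (h x) (h y))%N /\
    (kappa (diff_index (h x) (h y)) <= diff_index (h y) (h z))%N].
Proof.
move=> Ainf h_inj; have [c cP] := infinite_branch Ainf.
have two n : exists x y, [/\ A x, A y, h x <> h y &
    forall l, (l < n)%N -> h x l = c l /\ h y l = c l].
  have [d [d_inj dP]] := infinite_inj_seq (cP n).
  have [A0 c0] := dP 0%N; have [A1 c1] := dP 1%N.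
  exists (d 0%N), (d 1%N); split => //; last by move=> l ln; rewrite c0// c1.
  by move=> /h_inj; move=> /(_ A0 A1) /d_inj.
have [x Ax [xc xN]] :
    exists2 x, A x & h x <> c /\ forall l, (l < N)%N -> h x l = c l.
  have [x [y [Ax Ay xy xyN]]] := two N.
  have [xc|xc] := pselect (h x = c).
    exists y => //; split; first by rewrite -xc => yx; apply: xy.
    by move=> l /xyN[].
  by exists x => //; split => // l /xyN[].
have [xm xl] := diff_indexP xc.
set m := diff_index (h x) c in xm xl.
have [y [z [Ay Az yz yzM]]] := two (maxn m.+1 (kappa m)).
have hym : h y m = c m by have [] := yzM m (leq_maxl _ _).
have xym : diff_index (h x) (h y) = m.
  apply: diff_index_unique; first by rewrite hym.
  move=> l lm; rewrite xl//; have [|-> //] := yzM l.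
  by rewrite (leq_trans lm)// leq_max leqnSn.
exists x, y, z; split => //; first by split => // xy; rewrite -xy in hym;
    rewrite hym eqxx in xm.
rewrite xym; split; first exact: diff_index_ge.
apply: (leq_trans (leq_maxr m.+1 _)); apply: diff_index_ge => // l ln.
by have [-> ->] := yzM l ln.
Qed.

End branch.

(* Comparability of cardinals: a maximal injective partial map from [E] to the
   Cantor set is either total or onto. *)
Lemma uncountable_cantor (T : Type) (E : set T) : ~ countable E ->
  exists (D : set T) (h : T -> nat -> bool), [/\ D `<=` E, ~ countable D &
    forall x y, D x -> D y -> h x = h y -> x = y].
Proof.
move=> Eunc.
pose P : set (set (T * (nat -> bool))) := [set G |
  (forall p, G p -> E p.1) /\
  (forall p q, G p -> G q -> (p.1 = q.1 <-> p.2 = q.2))].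
have [|G [[GE Gpq] Gmax]] := @Zorn_bigcup _ P.
  move=> F FP Ftot; split=> [p [A FA Ap]|p q [A FA Ap] [B FB Bq]].
    by have [+ _] := FP _ FA; exact.
  have [AB|BA] := Ftot _ _ FA FB.
    by have [_] := FP _ FB; apply => //; exact: AB.
  by have [_] := FP _ FA; apply => //; exact: BA.
pose D := [set x | exists f, G (x, f)].
have /choice[h hP] (x : T) : exists f, D x -> G (x, f).
  by have [[f Gf]|nD] := pselect (D x); [exists f|exists (fun=> false)].
exists D, h; split.
- by move=> x [f /GE].
- move=> /countable_injP[e e_inj].
  have [x [Ex Dx]] : exists x, E x /\ ~ D x.
    apply: contrapT => nx; apply: Eunc; apply: (sub_countable (B := D)).
      apply: subset_card_le => x Ex; apply: contrapT => Dx.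
      by apply: nx; exists x.
    by apply/countable_injP; exists e.
  have /choice[F FP] (n : nat) :
      exists f, forall y g, e y = n -> G (y, g) -> g = f.
    have [[y [Dy <-]]|ny] := pselect (exists y, D y /\ e y = n).
      exists (h y) => y' g ey' Gg.
      have yy' : y' = y by apply: e_inj => //; rewrite inE//; exists g.
      by have [+ _] := Gpq _ _ Gg (hP _ Dy); exact.
    by exists (fun=> false) => y g ey Gg; exfalso; apply: ny; exists y;
        split => //; exists g.
  (* Cantor's diagonal: were the domain [D] countable, [f] would differ from every value in use, and
     pairing it with some [x] outside [D] would enlarge [G]. *)
  pose f n := ~~ F n n.
  have fG y g : G (y, g) -> g <> f.
    move=> Gg gf; have := FP (e y) y g erefl Gg => gF.
    have := congr1 (@^~ (e y)) gf; rewrite /f gF /=.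
    by case: (F _ _).
  apply: (Gmax (G `|` [set (x, f)])).
    split; first by left.
    by move=> GfG; apply: Dx; exists f; apply: GfG; right.
  split=> [p [/GE//|->//]|p q [Gp|->] [Gq|->]] /=.
  + exact: Gpq.
  + split=> [px|pf]; last by case: p Gp pf => y g Gg /= /(fG _ _ Gg).
    by exfalso; apply: Dx; rewrite -px; exists p.2; case: p Gp {px}.
  + split=> [px|pf]; last by case: q Gq pf => y g Gg /= /esym/(fG _ _ Gg).
    by exfalso; apply: Dx; rewrite px; exists q.2; case: q Gq {px}.
  + by [].
- by move=> x y Dx Dy; have [_ +] := Gpq _ _ (hP _ Dx) (hP _ Dy); exact.
Qed.

(** * Consequences of V being a k-space *)

Section k_space_cases.
Context {R : realType} {X : topologicalType} {V : topologicalLmodType R}.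
Context {i : X -> V}.
Hypotheses (Vfree : is_free_tvs i) (Xt : tychonoff_space X) (Vk : k_space V).
Local Notation ext := (ext Vfree).

Lemma compact_finite_closed (E D : set X) :
  (forall K : set X, compact K -> finite_set (K `&` E)) -> D `<=` E -> closed D.
Proof.
move=> EK DE; apply: (free_k_space Vfree Xt Vk) => K Kc.
apply: closed_subspaceW.
have /hausdorff_accessible/accessible_finite_set_closed := Xt.1; apply.
by apply: sub_finite_set (EK K Kc) => x [Dx Kx]; split => //; exact: DE.
Qed.

(** Domination of [x] by [v] plays the role of a coefficient at least 1 at [x] in a positive
    combination. Near [v], a functional vanishing on the support of [v] and coming from a function
    equal to 1 on the rest of [E] stays below 1, so only support points can be dominated;
    compactness does the rest. *)
Lemma dominated_finite (E : set X) (K : set V) :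
  (forall K : set X, compact K -> finite_set (K `&` E)) -> compact K ->
  finite_set [set x | E x /\ exists2 v, K v & forall phi : X -> R,
    continuous phi -> (forall y, 0 <= phi y <= 1) -> phi x <= ext phi v].
Proof.
move=> EK Kc.
pose dom v x := forall phi : X -> R,
  continuous phi -> (forall y, 0 <= phi y <= 1) -> phi x <= ext phi v.
apply: (@compact_local_ind _ (fun A => finite_set [set x | E x /\
  exists2 v, A v & dom v x]) K Kc).
- by apply: (sub_finite_set (B := set0)) => // x [_ []].
- move=> A B AB; apply: sub_finite_set => x [Ex [v Av vx]].
  by split => //; exists v => //; exact: AB.
- move=> A B Afin Bfin.
  apply: (sub_finite_set (B := _ `|` _)); last by rewrite finite_setU; split;
      [exact: Afin|exact: Bfin].
  by move=> x [Ex [v [Av|Bv] vx]]; [left|right]; split => //; exists v.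
- move=> v Kv; have [ys ysP] := ext_support Vfree v.
  have Ecl : closed (E `\` [set` ys]) by apply: compact_finite_closed EK _ =>
      x [].
  have [|phi [cphi phi01 phi0 phi1]] := @tychonoff_sep R X _ ys Xt Ecl.
    by move=> y yys [_]; apply.
  exists [set u | ext phi u < 1].
    have := @nbhs_ext_lt _ _ _ _ Vfree phi v 1 cphi.
    by rewrite ysP//; apply.
  apply: (sub_finite_set (B := [set` ys])) => //
      x [Ex [u [_ /= u1] /(_ phi cphi phi01) xu]].
  apply: contrapT => xys; have := phi1 x; rewrite leNgt in xu.
  by move=> phix; rewrite phix ?u1// in xu.
Qed.

(** Apply [fan_obstruction] to [i (x n j) - i x0] with level [n] and index [j]. A late row lies
    entirely in [U], although its indices are unbounded. *)
Lemma k_space_no_metric_fan (x0 : X) (x : nat -> nat -> X) :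
  (forall n (K : set X), compact K -> finite_set [set j | K (x n j)]) ->
  ~ (forall N, nbhs x0 N -> exists n, forall m j, (n <= m)%N -> N (x m j)).
Proof.
move=> xK xx0.
have [xi [xi_inj _]] : exists xi :
    nat -> X, injective xi /\ forall n, range (x 0%N) (xi n).
  apply: infinite_inj_seq => rfin.
  have := xK 0%N _ (finite_compact rfin).
  rewrite (_ : [set _ | _] = setT); first exact: infinite_nat.
  by rewrite -subTset => j _; exists j.
have c1 : continuous (cst 1 : X -> R) by move=> y; exact: cvg_cst.
pose w (t : nat * nat) : V := i (x t.1 t.2) - i x0.
have [U [kappa [U0 Uk]]] : exists (U : set V) (kappa : nat -> nat),
    nbhs 0 U /\ forall t, U (w t) -> (t.2 < kappa t.1)%N.
  apply: (@fan_obstruction R X V i Vfree Xt Vk xi xi_inj _ fst snd w 2).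
  - move=> n K Kc; pose K' := (fun v => v + i x0) @` K.
    have K'c : compact K'.
      apply: continuous_compact => //; apply: continuous_subspaceT => v.
      exact: (tvs_cvgD cvg_id (cvg_cst (i x0))).
    have Fc := compact_preimage_free Vfree Xt K'c.
    apply: (sub_finite_set (B := (fun j =>
        (n, j)) @` [set j | (i @^-1` K') (x n j)])).
      move=> [_ j] [/= -> Kw]; exists j => //=.
      by exists (w (n, j)) => //; rewrite /w /= subrK.
    by apply: finite_image; exact: xK.
  - move=> [n j]; exists [:: (1, x n j); (-1, x0)]; split => //.
    by rewrite !big_cons big_nil scale1r scaleN1r addr0.
  - move=> phi cphi phi01 e e0.
    have [|n nP] := xx0 [set y | `|phi x0 - phi y| <= e].
      exact: (@cvgrPdist_le R R^o _ _ _ phi (phi x0)).1 (cphi x0) e e0.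
    by exists n => -[m j] /= /nP H; rewrite /w extB// !extE// distrC; exact: H.
  - by move=> t; rewrite /w extB// !extE// subrr.
have [|n nP] := xx0 [set y | U (i y - i x0)].
  have xU : nbhs (i x0) [set v | U (v - i x0)].
    by apply/nbhs_addl; apply: filterS U0 => u /=; rewrite addrAC subrr add0r.
  exact: (free_continuous Vfree xU).
by have := Uk (n, kappa n) (nP n (kappa n) (leqnn _)); rewrite /= ltnn.
Qed.

(** Otherwise code an uncountable part by binary sequences and apply [fan_obstruction] to scaled
    sums of three points [x], [y], [z]: the level is the splitting index of [x], [y], the second
    index that of [y], [z]. [branch_triple] then violates the bound [kappa]. *)
Lemma k_space_compact_finite_countable (E : set X) :
  (forall K : set X, compact K -> finite_set (K `&` E)) -> countable E.
Proof.
move=> EK; apply: contrapT => Eunc.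
have [D [h [DE Dunc h_inj]]] := uncountable_cantor Eunc.
have [xi [xi_inj _]] : exists xi : nat -> X, injective xi /\ forall n, E (xi n).
  by apply: infinite_inj_seq => /finite_set_countable.
have c1 : continuous (cst 1 : X -> R) by move=> y; exact: cvg_cst.
pose T := {t : X * X * X | [/\ D t.1.1, D t.1.2, D t.2,
  h t.1.1 <> h t.1.2 & h t.1.2 <> h t.2]}.
pose m (t : T) := diff_index (h (sval t).1.1) (h (sval t).1.2).
pose k (t : T) := diff_index (h (sval t).1.2) (h (sval t).2).
pose w (t : T) : V :=
  (m t).+1%:R^-1 *: (i (sval t).1.1 + i (sval t).1.2 + i (sval t).2).
have [U [kappa [U0 Uk]]] : exists (U : set V) (kappa : nat -> nat),
    nbhs 0 U /\ forall t, U (w t) -> (k t < kappa (m t))%N.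
  apply: (@fan_obstruction R X V i Vfree Xt Vk xi xi_inj T m k w 3).
  (* At a fixed level the scaling is undone by a constant; each of the three points is dominated by
     their sum, so it ranges over a finite set. *)
  - move=> n K Kc; pose K' := (fun v => n.+1%:R *: v) @` K.
    have K'c : compact K'.
      apply: continuous_compact => //; apply: continuous_subspaceT => v.
      exact: (tvs_cvgZ (cvg_cst (n.+1%:R : R^o)) cvg_id).
    have := dominated_finite EK K'c; set F := [set _ | _] => Ffin.
    apply: (sub_finite_set (B := sval @^-1` (F `*` F `*` F))); last first.
      apply: finite_preimage; first by move=> [? ?] [? ?] _ _ /= st;
          exact: eq_exist.
      by apply: finite_setX => //; exact: finite_setX.
    move=> t [mt Kw]; have [Dx Dy Dz _ _] := svalP t.
    have K'w : K' (i (sval t).1.1 + i (sval t).1.2 + i (sval t).2).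
      by exists (w t) => //; rewrite /w mt scalerA mulfV// scale1r.
    split; [split|]; (split; first exact: DE); (eexists; first exact: K'w);
      move=> phi cphi phi01; rewrite !extD// !extE//;
      have /andP[? _] := phi01 (sval t).1.1; have /andP[? _] :=
          phi01 (sval t).1.2;
      have /andP[? _] := phi01 (sval t).2; lra.
  - move=> t; exists [:: ((m t).+1%:R^-1, (sval t).1.1);
      ((m t).+1%:R^-1, (sval t).1.2); ((m t).+1%:R^-1, (sval t).2)]; split =>
          //.
    by rewrite !big_cons big_nil addr0 /w !scalerDr addrA.
  - move=> phi cphi phi01 e e0; exists (Num.truncn (3 / e)) => t mt.
    rewrite /w extZ// !extD// !extE// normrM gtr0_norm ?invr_gt0//.
    rewrite mulrC ler_pdivrMr//.
    have /andP[x0 x1] := phi01 (sval t).1.1; have /andP[y0 y1] :=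
        phi01 (sval t).1.2.
    have /andP[z0 z1] := phi01 (sval t).2; rewrite ger0_norm ?addr_ge0//.
    apply: (@le_trans _ _ 3); first by lra.
    rewrite mulrC -ler_pdivrMr// (le_trans (ltW (truncnS_gt _)))// ler_nat ltnS.
    exact: mt.
  - move=> t; rewrite /w extZ// !extD// !extE// mulr_ge0 ?invr_ge0//.
    by rewrite /cst !addr_ge0.
have [W W0 WU] := nbhs0_comb U0; have [Z Z0 ZW] := nbhs0_comb W0.
have /choice[N NP] (x : X) :
    exists N, forall n, (N <= n)%N -> Z (n.+1%:R^-1 *: i x).
  have [d d0 dZ] := nbhs0_absorb (i x) Z0; exists (Num.truncn d^-1) => n nd.
  apply: dZ; rewrite gtr0_norm ?invr_gt0// invf_ple ?posrE//.
  by rewrite (le_trans (ltW (truncnS_gt _)))// ler_nat ltnS.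
(* Uncountably many points and countably many thresholds [N x]: infinitely many points share a
   common threshold [n]. *)
have [n An] : exists n, infinite_set (D `&` [set x | (N x <= n)%N]).
  apply: contrapT => nA; apply: Dunc.
  rewrite (_ : D = \bigcup_n (D `&` [set x | (N x <= n)%N])).
    apply: bigcup_countable => // n _; apply: finite_set_countable.
    by apply: contrapT => An; apply: nA; exists n.
  apply/seteqP; split=> [x Dx|x [n _ [Dx _]]]; last exact: Dx.
  by exists (N x) => //; split => //=.
have [x [y [z [[Dx Nx] [Dy Ny] [Dz Nz] [xy yz] [nm km]]]]] :=
  branch_triple n kappa An (fun x y Ax Ay => h_inj x y Ax.1 Ay.1).
pose t : T := exist _ (x, y, z) (And5 Dx Dy Dz xy yz).
suff /Uk : U (w t) by rewrite ltnNge => /negP; apply; exact: km.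
have Zw q : (N q <= n)%N -> Z ((m t).+1%:R^-1 *: i q).
  by move=> Nq; apply: NP; rewrite (leq_trans Nq).
rewrite /w !scalerDr /=.
have Zy0 : Z 0 by exact: nbhs_singleton.
have Wz : W ((m t).+1%:R^-1 *: i z).
  have := ZW 1 0 _ 0 _ _ (Zw z Nz) Zy0; rewrite scale1r scaler0 addr0.
  by apply; rewrite ?normr1 ?normr0.
have Wxy : W ((m t).+1%:R^-1 *: i x + (m t).+1%:R^-1 *: i y).
  have := ZW 1 1 _ _ _ _ (Zw x Nx) (Zw y Ny); rewrite !scale1r.
  by apply; rewrite normr1.
have := WU 1 1 _ _ _ _ Wxy Wz; rewrite !scale1r.
by apply; rewrite normr1.
Qed.

End k_space_cases.

(** * Relatively compact subsets of metric spaces *)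

Section metric.
Context {R : realType} {M : metricType R}.
Implicit Types (A S D K : set M) (p q : M) (e : R).

Definition separated e D := forall p q, D p -> D q -> p != q -> e <= mdist p q.

Lemma maximal_separated A e : 0 < e ->
  exists D, [/\ D `<=` A, separated e D &
    forall p, A p -> exists2 q, D q & mdist q p < e].
Proof.
move=> e0; pose P := [set D | D `<=` A /\ separated e D].
have [|D [[DA De] Dmax]] := @Zorn_bigcup _ P.
  move=> F FP Ftot; split=> [p [D FD Dp]|p q [D FD Dp] [D' FD' Dq]].
    by have [+ _] := FP _ FD; exact.
  have [DD'|D'D] := Ftot _ _ FD FD'.
    by have [_] := FP _ FD'; apply => //; exact: DD'.
  by have [_] := FP _ FD; apply => //; exact: D'D.
exists D; split => // p Ap; apply: contrapT => nq.
have far q : D q -> e <= mdist q p.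
  by move=> Dq; rewrite leNgt; apply/negP => qp; apply: nq; exists q.
have Dp : ~ D p by move=> /far; rewrite mdistxx leNgt e0.
apply: (Dmax (D `|` [set p])).
  by split; [left|move=> DpD; apply: Dp; apply: DpD; right].
split; first by move=> q [/DA|->].
move=> q r [Dq|->] [Dr|->] qr; last by rewrite eqxx in qr.
- exact: De.
- exact: far.
- by rewrite metric_sym; exact: far.
Qed.

Lemma separated_compact_finite e D K : 0 < e -> separated e D -> compact K ->
  finite_set (K `&` D).
Proof.
move=> e0 De Kc.
apply: (@compact_local_ind _ (fun A => finite_set (A `&` D)) K Kc).
- by rewrite set0I.
- by move=> A B AB; apply: sub_finite_set; exact: setSI.
- by move=> A B Af Bf; rewrite setIUl finite_setU.
- move=> p Kp; have e20 : 0 < e / 2 by rewrite divr_gt0.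
  exists (ball p (e / 2)); first exact: nbhsx_ballx.
  have [[q [Dq pq]]|nq] := pselect (exists q, D q /\ ball p (e / 2) q);
      last first.
    apply: (sub_finite_set (B := set0)) => // q [[_ pq] Dq].
    by apply: nq; exists q.
  apply: (sub_finite_set (B := [set q])) => // r [[_ pr] Dr] /=.
  apply/eqP; apply: contraT => rq; move: pq pr; rewrite !ballEmdist /= => pq pr.
  have := De _ _ Dr Dq rq; have := metric_triangle r p q.
  by rewrite (metric_sym r p); lra.
Qed.

Lemma mdist_lt_nbhs p e : 0 < e -> nbhs p [set q | mdist p q < e].
Proof. by move=> e0; rewrite -ballEmdist; exact: nbhsx_ballx. Qed.

Lemma invS_lt e : 0 < e -> exists n : nat, n.+1%:R^-1 < e.
Proof.
move=> e0; exists (Num.truncn e^-1).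
by rewrite invf_plt ?posrE// truncnS_gt.
Qed.

(** The hypothesis gives total boundedness, since an infinite separated sequence meets a compact set
    finitely often. An ultrafilter is then Cauchy; points [a n] of [A] follow it, and a cluster
    point of those lying in some compact [K] is its limit. [K] thus replaces completeness of [M]. *)
Lemma compact_closure_seq A :
  (forall a : nat -> M, (forall n, A (a n)) ->
    exists2 K, compact K & infinite_set [set n | K (a n)]) ->
  compact (closure A).
Proof.
move=> AK.
have net e : 0 < e -> exists2 D, finite_set D &
    forall p, A p -> exists2 q, D q & mdist q p < e.
  move=> e0; have [D [DA De Dnet]] := maximal_separated A e0.
  exists D => //; apply: contrapT => /infinite_inj_seq[a [a_inj aD]].
  have [K Kc] := AK a (fun n => DA _ (aD n)); apply.
  apply: (sub_finite_set (B := a @^-1` (K `&` D))); first by move=> n Kn; split.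
  apply: finite_preimage; first by move=> ? ? _ _; exact: a_inj.
  exact: separated_compact_finite De Kc.
rewrite compact_ultra => F FU FA.
have small e : 0 < e -> exists q, F [set p | mdist q p < e].
  move=> e0; have n0 : 0 < e / 2 by rewrite divr_gt0.
  have [D Dfin Dnet] := net _ n0; apply: contrapT => nq.
  have FD : F (\bigcap_(q in D) ~` [set p | mdist q p < e]).
    rewrite -bigsetI_fset_set// big_seq.
    apply: (big_ind F); [exact: filterT|by move=> *; exact: filterI|].
    move=> q; rewrite in_fset_set// inE => Dq.
    have [Fq|//] := in_ultra_setVsetC [set p | mdist q p < e] FU.
    by exfalso; apply: nq; exists q.
  have [p [Ap Dp]] := filter_ex (filterI FA FD).
  have [r [Ar pr]] := Ap _ (mdist_lt_nbhs p n0).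
  have [q Dq qr] := Dnet r Ar; apply: (Dp q Dq) => /=.
  have := metric_triangle q r p; rewrite (metric_sym r p).
  by move: qr pr => /=; lra.
have /choice[q qP] n : exists q, F [set p | mdist q p < n.+1%:R^-1]
    by exact: small.
have /choice[a aP] n : exists r, A r /\
    F [set p | mdist r p < 3 * n.+1%:R^-1].
  have n0 : 0 < n.+1%:R^-1 :> R by [].
  have [p [Ap qp]] := filter_ex (filterI FA (qP n)).
  have [r [Ar pr]] := Ap _ (mdist_lt_nbhs p n0).
  exists r; split => //; apply: filterS (qP n) => s /= qs.
  have := metric_triangle r p s; have := metric_triangle p (q n) s.
  rewrite (metric_sym r p) (metric_sym p (q n)).
  by move: qp pr qs => /=; move: n.+1%:R^-1 => e; lra.
have [K Kc Kinf] := AK a (fun n => (aP n).1).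
have Kex N : exists2 n, (N <= n)%N & K (a n).
  apply: contrapT => nN; apply: Kinf; apply: (sub_finite_set (B := `I_N)) =>
      // n Kn /=.
  by rewrite ltnNge; apply/negP => Nn; apply: nN; exists n.
pose G : set_system M :=
    [set B | exists N, forall n, (N <= n)%N -> K (a n) -> B (a n)].
have GP : ProperFilter G.
  split.
    by move=> [N NP]; have [n Nn Kn] := Kex N; exact: (NP n).
  split.
  - by exists 0%N.
  - move=> B B' [N NP] [N' NP']; exists (maxn N N') => n.
    by rewrite geq_max => /andP[/NP ? /NP' ?] Kn; split; auto.
  - by move=> B B' BB' [N NP]; exists N => n Nn Kn; exact/BB'/NP.
have [p [Kp pG]] : K `&` cluster G !=set0 by apply: Kc; exists 0%N.
have Fp : F --> p.
  move=> N; rewrite -nbhs_ballE => -[e /= e0 eN].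
  (* The balls around [a n] have radius [3 / (n + 1)], so [e / 6] leaves [e / 2] for the distance to
     [p]. *)
  have e40 : 0 < e / 6 by rewrite divr_gt0.
  have [n0 n0e] := invS_lt e40.
  have Gn : G [set r | F [set s | mdist r s < e / 2]].
    exists n0 => n n0n _; apply: filterS (aP n).2 => s /= /lt_le_trans; apply.
    have : n.+1%:R^-1 <= n0.+1%:R^-1 :> R by rewrite lef_pV2 ?posrE// ler_nat.
    by move: n0e; move: n0.+1%:R^-1 n.+1%:R^-1 => s0 s1; lra.
  have e20 : 0 < e / 2 by rewrite divr_gt0.
  have [r [/= Fr pr]] := pG _ _ Gn (mdist_lt_nbhs p e20).
  apply: filterS Fr => s /= rs; apply: eN; rewrite ballEmdist /=.
  by have := metric_triangle p r s; move: pr => /=; lra.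
exists p; split => //; apply: closed_closure => N pN.
by have [r [Ar Nr]] := filter_ex (filterI FA (Fp _ pN)); exists r.
Qed.

Lemma not_compact_closure A : ~ compact (closure A) ->
  exists a : nat -> M, (forall n, A (a n)) /\
    forall K, compact K -> finite_set [set n | K (a n)].
Proof.
move=> nA; apply: contrapT => na; apply: nA; apply: compact_closure_seq => a aA.
apply: contrapT => nK; apply: na; exists a; split => // K Kc.
by apply: contrapT => Kinf; apply: nK; exists K.
Qed.

Lemma compact_closureS A B :
    A `<=` B -> compact (closure B) -> compact (closure A).
Proof. by rewrite -!precompactE; exact: precompact_subset. Qed.

(** Either some [p] has no neighbourhood with relatively compact trace on [S], or a separated subset
    of [S] is uncountable, or countably many small balls with relatively compact traces suffice;
    their finite unions then absorb every relatively compact part of [S]. *)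
Lemma relatively_compact_trichotomy S : [\/
  exists C : nat -> set M, (forall n, compact (C n)) /\
    forall A, A `<=` S -> compact (closure A) -> exists n, A `<=` C n,
  exists p (d : nat -> nat -> M), (forall n j, S (d n j)) /\
    (forall n j, mdist p (d n j) < n.+1%:R^-1) /\
    forall n K, compact K -> finite_set [set j | K (d n j)]
| exists D, [/\ D `<=` S, ~ countable D &
    forall K, compact K -> finite_set (K `&` D)]].
Proof.
have [[p pP]|locc] := pselect (exists p, forall n,
    ~ compact (closure (S `&` [set q | mdist p q < n.+1%:R^-1]))).
  apply: Or32; exists p.
  have /choice[d dP] n := not_compact_closure (pP n).
  exists d; split=> [n j|]; first by have [/(_ j)[]] := dP n.
  by split=> [n j|n]; [have [/(_ j)[]] := dP n|have [] := dP n].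
(* The factor 4 leaves a centre [q] in [D k] at distance below [1 / (2 (k + 1))] from a limit point
   [p], so the ball of that radius at [p] lies in the ball of radius [1 / (k + 1)] at [q]. *)
pose eps n : R := n.+1%:R^-1 / 4.
have eps0 n : 0 < eps n by rewrite divr_gt0.
have /choice[D DP] n := maximal_separated S (eps0 n).
have [Dcount|/existsNP[n nD]] := pselect (forall n, countable (D n));
    last first.
  apply: Or33; exists (D n); have [DS De _] := DP n; split => // K Kc.
  exact: separated_compact_finite De Kc.
apply: Or31.
have Qc : countable (\bigcup_n D n) by apply: bigcup_countable.
(* Relative compactness is part of membership, so [B q k] is empty for a bad pair and always has
   compact closure. *)
pose B q k := [set p | S p /\ mdist q p < k.+1%:R^-1 /\
  compact (closure (S `&` [set r | mdist q r < k.+1%:R^-1]))].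
have Brc q k : compact (closure (B q k)).
  have [c|nc] :=
      pselect (compact (closure (S `&` [set r | mdist q r < k.+1%:R^-1]))).
    by apply: compact_closureS c => p [Sp [qp _]].
  rewrite (_ : B q k = set0) ?closure0; first exact: compact0.
  by rewrite -subset0 => p [_ []].
have /countable_injP[g g_inj] := Qc.
pose I n := [set q | (\bigcup_n D n) q /\ (g q < n)%N] `*` `I_n.
have Ifin n : finite_set (I n).
  apply: finite_setX; last exact: finite_II.
  have -> : [set q | (\bigcup_n D n) q /\ (g q < n)%N] =
      (fun q : {q | (\bigcup_n D n) q} => sval q) @` ((g \o sval) @^-1` `I_n).
    by apply/seteqP; split=> [q [Qq qn]|_ [[q Qq] qn <-]] //;
        exists (exist _ q Qq).
  apply: finite_image; apply: finite_preimage; last exact: finite_II.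
  move=> [q Qq] [r Qr] _ _ /= gqr; apply: eq_exist.
  by apply: g_inj; rewrite ?inE.
pose C n := \bigcup_(t in I n) closure (B t.1 t.2).
have Cmono n m : (n <= m)%N -> C n `<=` C m.
  move=> nm p [[q k] [[Qq qn] kn] qp]; exists (q, k) => //.
  by split; [split => //; exact: leq_trans nm|exact: leq_trans nm].
exists C; split=> [n|A AS Ac].
  by rewrite /C -bigsetU_fset_set//; apply: bigsetU_compact => t _; exact: Brc.
(* Local induction runs over the compact [closure A], while only the points of [A] itself are to be
   covered. *)
suff [n nP] : exists n, A `&` closure A `<=` C n.
  by exists n => p Ap; apply: nP; split => //; exact: subset_closure.
apply: (@compact_local_ind _ (fun E =>
    exists n, A `&` E `<=` C n) (closure A) Ac).
- by exists 0%N; rewrite setI0.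
- by move=> E E' EE' [n nP]; exists n; apply: subset_trans nP; exact: setIS.
- move=> E E' [n nP] [m mP]; exists (maxn n m); rewrite setIUr subUset; split.
    by apply: (subset_trans nP); apply: Cmono; exact: leq_maxl.
  by apply: (subset_trans mP); apply: Cmono; exact: leq_maxr.
- move=> p Ap; have /existsNP[n0 /contrapT pc] : ~ forall n, ~ compact (closure
      (S `&` [set q | mdist p q < n.+1%:R^-1])).
    by move=> pP; apply: locc; exists p.
  have r0 : 0 < n0.+1%:R^-1 / 2 :> R by rewrite divr_gt0.
  have [k kr] := invS_lt r0.
  have [r [/AS Sr pr]] := Ap _ (mdist_lt_nbhs p (eps0 k)).
  have [DS De Dnet] := DP k; have [q Dq qr] := Dnet r Sr.
  have qp : mdist q p < k.+1%:R^-1 / 2.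
    have := metric_triangle q r p; rewrite (metric_sym r p).
    move: qr pr; rewrite /eps /=; move: k.+1%:R^-1 => e; lra.
  have k0 : 0 < k.+1%:R^-1 / 2 :> R by rewrite divr_gt0.
  exists [set s | mdist p s < k.+1%:R^-1 / 2]; first exact: mdist_lt_nbhs.
  exists (maxn (g q) k).+1 => s [As [_ /= ps]].
  exists (q, k).
    split => /=; last by rewrite ltnS leq_maxr.
    by split; [exists k|rewrite ltnS leq_maxl].
  apply: subset_closure; split; first exact: AS.
  split.
    have := metric_triangle q p s; move: qp ps; move: k.+1%:R^-1 => e; lra.
  apply: compact_closureS pc => t [St /= qt]; split => //=.
  have := metric_triangle p q t; rewrite (metric_sym p q).
  by move: r0 kr qp qt; move: k.+1%:R^-1 n0.+1%:R^-1 => e e'; lra.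
Qed.

End metric.

(** * Transfer along the k*-metrization and the equivalence *)

Lemma k_omega_k_space (Y : topologicalType) : k_omega_space Y -> k_space Y.
Proof. by move=> [K [Kc _ Kcl]] C CK; apply: Kcl => n; exact: CK. Qed.

Lemma closed_inS (Y : topologicalType) (K L C : set Y) :
  K `<=` L -> closed_in L C -> closed_in K C.
Proof.
move=> KL /closed_subspaceP[D Dcl DL]; apply/closed_subspaceP; exists D => //.
apply/seteqP; split=> [x [Dx Kx]|x [[Cx _] Kx]].
  by have [[Cx _] _] : (C `&` L `&` L) x by rewrite -DL; split => //; exact: KL.
have [Dx _] : (D `&` L) x by rewrite DL; do !split => //; exact: KL.
by split.
Qed.

(** Apply the trichotomy to [range s]. The compacts [C n] map onto a family absorbing all compact
    sets of [X]; the other two cases push forward under [f] to configurations excluded above. *)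
Lemma kstar_free_k_space (R : realType) (X : topologicalType)
    (V : topologicalLmodType R) (i : X -> V) :
  tychonoff_space X -> kstar_metrizable R X -> is_free_tvs i ->
  k_space V -> k_omega_space X.
Proof.
move=> Xt [_ [M [f [s [cf _ fs sK]]]]] Vfree Vk.
(* On [range s] the map [s] inverts [f], so [f (d j)] in [K] puts [d j] in the relatively compact
   set [s(K)]. *)
have Kfin (d : nat -> M) : (forall j, range s (d j)) ->
    (forall K, compact K -> finite_set [set j | K (d j)]) ->
    forall K : set X, compact K -> finite_set [set j | K (f (d j))].
  move=> ds dK K /sK/dK; apply: sub_finite_set => j /= Kj.
  by have [x _ xd] := ds j; rewrite -xd fs in Kj *; apply: subset_closure;
      exists x.
have [[C [Cc CP]]|[p [d [ds [pd dK]]]]|[D [Ds Dunc DK]]] :=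
    relatively_compact_trichotomy (range s).
- have KC (K : set X) : compact K -> exists n, K `<=` f @` C n.
    move=> /sK Kc; have [|n nP] := CP (s @` K) _ Kc.
      by move=> _ [x _ <-]; exists x.
    by exists n => x Kx; exists (s x) => //; apply: nP; exists x.
  exists (fun n => f @` C n); split.
  + by move=> n; apply: continuous_compact => //; exact: continuous_subspaceT.
  + rewrite -subTset => x _; have [n nP] := KC [set x] (@compact_set1 _ x).
    by exists n => //; exact: nP.
  + move=> F FC; apply: (free_k_space Vfree Xt Vk) => K /KC[n KCn].
    exact: closed_inS (FC n).
- exfalso; apply: (k_space_no_metric_fan Vfree Xt Vk
    (x0 := f p) (x := fun n j => f (d n j))).
    by move=> n; apply: Kfin; [exact: ds|exact: dK].
  move=> N /cf; rewrite /= -nbhs_ballE => -[e /= e0 eN].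
  have [n ne] := invS_lt e0; exists n => m j nm; apply: eN.
  rewrite ballEmdist /= (lt_trans (pd m j))// (le_lt_trans _ ne)//.
  by rewrite lef_pV2 ?posrE// ler_nat.
- exfalso; apply: Dunc.
  have : countable (f @` D).
    apply: (k_space_compact_finite_countable Vfree Xt Vk) => K Kc.
    apply: sub_finite_set (finite_image f (DK _ (sK _ Kc))) => y [Ky [q Dq qy]].
    exists q => //; split => //; have [x _ xq] := Ds q Dq.
    by rewrite -qy -xq fs in Ky; rewrite -xq; apply: subset_closure; exists x.
  move=> /countable_injP[g g_inj]; apply/countable_injP; exists (g \o f).
  move=> q r; rewrite !inE => Dq Dr /g_inj; rewrite !inE => fqr.
  have {}fqr : f q = f r by apply: fqr; [exists q|exists r].
  have [x _ xq] := Ds q Dq; have [y _ yr] := Ds r Dr.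
  by rewrite -xq -yr !fs in fqr *; rewrite fqr.
Qed.

Theorem theorem3p13 (R : realType) (X : topologicalType)
    (V : topologicalLmodType R) (i : X -> V) :
  tychonoff_space X -> kstar_metrizable R X -> is_free_tvs i ->
  [<-> k_space V; k_omega_space V; k_omega_space X].
Proof.
move=> Xt Xk Vfree.
have VX : k_space V -> k_omega_space X by exact: kstar_free_k_space Xt Xk Vfree.
have XV : k_omega_space X -> k_omega_space V.
  by move=> [K [Kc Kcover Kcl]]; exact: (@free_k_omega _ _ _ _ Vfree Xt K).
tfae.
- by move=> /VX/XV.
- by move=> /k_omega_k_space/VX.
- by move=> /XV/k_omega_k_space.
Qed.
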